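(* Let $G$ be a finite, simple, non-abelian group, and let $m$ be the size of the largest conjugacy class in $G$. Every simple factor (composition factor) occurring in $\mathcal{GT}_1(G)$ is isomorphic to one of the following: (a) $C_2$; (b) $C_3$; (c) a subquotient of $\mathrm{Out}(G)$; (d) an alternating group $A_s$ with $s\le \frac{m^2}{|G|}$.
   Context: $C_n$ denotes the cyclic group of order $n$. For a finite group $G$, let $F_2=\langle x,y\rangle$ be the free group on two generators, and let $N_G$ be the intersection of all normal subgroups $N$ of $F_2$ with $F_2/N\cong G$ (with $N_G=F_2$ if there are none). Put $\overline{G}=F_2/N_G$, a finite group; the images of $x,y$ in $\overline{G}$ are still denoted $x,y$. There are automorphisms $\theta,\delta$ of $\overline{G}$ with $\theta(x)=y$, $\theta(y)=x$ and $\delta(x)=y^{-1}x^{-1}$, $\delta(y)=y$. The group $\mathcal{GT}_1(G)$ is the image in $\mathrm{Out}(\overline{G})$ of the subgroup of all $\varphi\in\mathrm{Aut}(\overline{G})$ such that (1) $\varphi(x)$ is conjugate to $x$ in $\overline{G}$, and (2) the class of $\varphi$ in $\mathrm{Out}(\overline{G})$ commutes with the classes of $\theta$ and of $\delta$. *)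

(* Defs.v *)
From HB Require Import structures.
From mathcomp Require Import all_boot all_order all_algebra all_fingroup.
From mathcomp Require Import all_solvable.
From mathcomp Require Import boolp.

Set Implicit Arguments.
Unset Strict Implicit.
Unset Printing Implicit Defensive.

Local Open Scope group_scope.
Local Open Scope quotient_scope.

(* fingroup also has a [repr], which picks an element of a set. *)
Local Notation repr := generic_quotient.repr.

(* (i, e) stands for a generator (x if i = false, y if i = true) when
   e = false, and for its inverse when e = true. *)
Definition letter := (bool * bool)%type.

Definition linv (a : letter) : letter := (a.1, ~~ a.2).

Arguments linv : simpl never.

Lemma linvK : involutive linv.
Proof. by case=> i e; rewrite /linv /= negbK. Qed.

Definition reduced (w : seq letter) := sorted (fun a b => b != linv a) w.

Definition push (a : letter) (w : seq letter) : seq letter :=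
  if w is b :: w' then if b == linv a then w' else a :: w else [:: a].

Lemma push_reduced a w : reduced w -> reduced (push a w).
Proof.
case: w => //= b w rw; case: ifP => [_|/= ->//].
exact: path_sorted rw.
Qed.

Lemma pushK a w : reduced w -> push (linv a) (push a w) = w.
Proof.
case: w => [|b w] /=; first by rewrite linvK eqxx.
case: ifP => [/eqP->|_] /=; last by rewrite linvK eqxx.
by case: w => [|c w] //=; rewrite /reduced /= => /andP[/negbTE->].
Qed.

Lemma pushVK a w : reduced w -> push a (push (linv a) w) = w.
Proof. by move=> rw; rewrite -{1}(linvK a) pushK. Qed.

Lemma foldr_push_reduced u w : reduced w -> reduced (foldr push w u).
Proof. by move=> rw; elim: u => //= a u /push_reduced. Qed.

Lemma foldr_push_push a u w : reduced w ->
  foldr push w (push a u) = push a (foldr push w u).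
Proof.
move=> rw; case: u => //= b u; case: ifP => [/eqP-> /=|//].
by rewrite pushVK // foldr_push_reduced.
Qed.

Lemma foldr_push_nil u : reduced u -> foldr push [::] u = u.
Proof.
elim: u => //= a u IHu rau; rewrite (IHu (path_sorted rau)).
by case: u rau {IHu} => //= b u /andP[/negbTE->].
Qed.

Lemma foldr_pushA u v w : reduced w ->
  foldr push w (foldr push v u) = foldr push (foldr push w v) u.
Proof. by move=> rw; elim: u => //= a u <-; rewrite foldr_push_push. Qed.

Definition inv_word (u : seq letter) := rev (map linv u).

Lemma inv_word_reduced u : reduced u -> reduced (inv_word u).
Proof.
rewrite /reduced /inv_word rev_sorted sorted_map.
apply: sub_sorted => a b /=; apply: contraNneq => ->.
by rewrite linvK.
Qed.

Lemma foldr_push_inv u w : reduced w ->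
  foldr push (foldr push w u) (inv_word u) = w.
Proof.
rewrite /inv_word => rw; elim: u => //= a u IHu.
by rewrite rev_cons foldr_rcons pushK // foldr_push_reduced.
Qed.

(* The free group on x and y: reduced words, multiplied by concatenation
   followed by free reduction. *)
Definition F2 := {w : seq letter | reduced w}.

HB.instance Definition _ := Countable.on F2.

Definition F2_one : F2 := Sub [::] isT.
Definition F2_mul (u v : F2) : F2 :=
  Sub (foldr push (val v) (val u)) (foldr_push_reduced (val u) (valP v)).
Definition F2_inv (u : F2) : F2 :=
  Sub (inv_word (val u)) (inv_word_reduced (valP u)).

Lemma F2_mulA : associative F2_mul.
Proof. by move=> u v w; apply: val_inj; rewrite /= foldr_pushA ?(valP w). Qed.

Lemma F2_mul1 : left_id F2_one F2_mul.
Proof. by move=> u; apply: val_inj. Qed.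

Lemma F2_mulr1 : right_id F2_one F2_mul.
Proof. by move=> u; apply: val_inj; rewrite /= foldr_push_nil ?(valP u). Qed.

Lemma F2_mulV : left_inverse F2_one F2_inv F2_mul.
Proof.
move=> u; apply: val_inj; rewrite /= -{1}(foldr_push_nil (valP u)).
exact: foldr_push_inv.
Qed.

Lemma F2_mulrV : right_inverse F2_one F2_inv F2_mul.
Proof.
move=> u; rewrite -{1}(F2_mul1 u) -(F2_mulV (F2_inv u)) -!F2_mulA.
by rewrite (F2_mulA _ u) F2_mulV F2_mul1.
Qed.

HB.instance Definition _ :=
  isGroup.Build F2 F2_mulA F2_mul1 F2_mulr1 F2_mulV F2_mulrV.

Definition F2x : F2 := Sub [:: (false, false)] isT.
Definition F2y : F2 := Sub [:: (true, false)] isT.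

Section Evaluation.

Variables (H : groupType) (a b : H).

Definition eval_letter (l : letter) : H :=
  let g := if l.1 then b else a in if l.2 then g^-1 else g.

Definition eval_word (w : seq letter) : H :=
  foldr (fun l h => eval_letter l * h) 1 w.

Definition F2_eval (w : F2) : H := eval_word (val w).

Lemma eval_linv l : eval_letter (linv l) = (eval_letter l)^-1.
Proof. by case: l => i [] /=; rewrite /eval_letter /= ?invgK. Qed.

Lemma eval_push l w : eval_word (push l w) = eval_letter l * eval_word w.
Proof.
case: w => //= l' w; case: ifP => //= /eqP->.
by rewrite eval_linv mulgA mulgV mul1g.
Qed.

Lemma F2_evalM : {morph F2_eval : u v / u * v}.
Proof.
move=> u v; rewrite /F2_eval /=; elim: (val u) => [|l w IHw] /=.
  by rewrite mul1g.
by rewrite eval_push IHw mulgA.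
Qed.

HB.instance Definition _ := isMultiplicative.Build F2 H F2_eval F2_evalM.

Lemma F2_eval1 : F2_eval 1 = 1. Proof. by []. Qed.

Lemma F2_evalV u : F2_eval u^-1 = (F2_eval u)^-1.
Proof.
by apply: (mulgI (F2_eval u)); rewrite -F2_evalM !mulgV.
Qed.

Lemma F2_evalx : F2_eval F2x = a. Proof. exact: mulg1. Qed.
Lemma F2_evaly : F2_eval F2y = b. Proof. exact: mulg1. Qed.

Lemma F2_eval_unique (f : {multiplicative F2 -> H}) :
  f F2x = a -> f F2y = b -> f =1 F2_eval.
Proof.
move=> fx fy [w rw]; rewrite /F2_eval /=.
have f1 : f 1 = 1 by apply: (mulgI (f 1)); rewrite -gmulfM !mulg1.
have fV u : f u^-1 = (f u)^-1.
  by apply: (mulgI (f u)); rewrite -gmulfM !mulgV.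
elim: w rw => [|l w IHw] rw.
  by rewrite -[RHS]f1; congr (f _); apply: val_inj.
have rl : reduced [:: l] by [].
have -> : exist _ (l :: w) rw
        = (exist _ [:: l] rl : F2) * exist _ w (path_sorted rw).
  by apply: val_inj => /=; case: w rw {IHw} => //= c w /andP[/negbTE->].
rewrite gmulfM IHw /=; congr (_ * _).
case: l {rw IHw} rl => [[] []] rl; rewrite /eval_letter /= -?fx -?fy -?fV;
  by congr (f _); apply: val_inj.
Qed.

End Evaluation.

Record normalSubgroup (F : groupType) := NormalSubgroup {
  nsub_pred :> {pred F};
  nsub1 : 1 \in nsub_pred;
  nsubM : forall u v, u \in nsub_pred -> v \in nsub_pred ->
            u * v \in nsub_pred;
  nsubV : forall u, u \in nsub_pred -> u^-1 \in nsub_pred;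
  nsubJ : forall u v, u \in nsub_pred -> u ^ v \in nsub_pred
}.

Section Quotient.

Variables (F : groupType) (N : normalSubgroup F).

Definition nsub_rel : rel F := fun u v => u^-1 * v \in N.

Lemma nsub_relxx : reflexive nsub_rel.
Proof. by move=> u; rewrite /nsub_rel mulVg nsub1. Qed.

Lemma nsub_rel_sym : symmetric nsub_rel.
Proof.
move=> u v; apply/idP/idP => /nsubV; by rewrite /nsub_rel invgM invgK.
Qed.

Lemma nsub_rel_trans : transitive nsub_rel.
Proof.
move=> v u w uv vw; rewrite /nsub_rel.
by have := nsubM uv vw; rewrite mulgA -(mulgA u^-1) mulgV mulg1.
Qed.

Canonical nsub_equiv_rel :=
  EquivRel nsub_rel nsub_relxx nsub_rel_sym nsub_rel_trans.

Definition quo := {eq_quot nsub_rel}.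

HB.instance Definition _ := Choice.on quo.
HB.instance Definition _ := EqQuotient.on quo.

Definition quo_pi (u : F) : quo := \pi_quo u.

Lemma quo_piP u v : reflect (quo_pi u = quo_pi v) (u^-1 * v \in N).
Proof. exact: (eqquotP quo). Qed.

Lemma quo_surj (q : quo) : exists u, quo_pi u = q.
Proof. by exists (repr q); rewrite /quo_pi reprK. Qed.

Definition quo_one : quo := quo_pi 1.
Definition quo_mul (p q : quo) : quo := quo_pi (repr p * repr q).
Definition quo_inv (p : quo) : quo := quo_pi (repr p)^-1.

Lemma quo_mulE u v : quo_mul (quo_pi u) (quo_pi v) = quo_pi (u * v).
Proof.
apply/quo_piP; set u' := repr _; set v' := repr _.
have Nu : u'^-1 * u \in N by apply/quo_piP; rewrite /quo_pi reprK.
have Nv : v'^-1 * v \in N by apply/quo_piP; rewrite /quo_pi reprK.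
have -> : (u' * v')^-1 * (u * v) = (u'^-1 * u) ^ v' * (v'^-1 * v).
  by rewrite conjgE invgM -!mulgA (mulVKg v').
exact: nsubM (nsubJ _ Nu) Nv.
Qed.

Lemma quo_invE u : quo_inv (quo_pi u) = quo_pi u^-1.
Proof.
apply/quo_piP; set u' := repr _; rewrite invgK.
have Nu : u'^-1 * u \in N by apply/quo_piP; rewrite /quo_pi reprK.
have := nsubV (nsubJ u'^-1 Nu).
by rewrite conjgE invgK -mulgA (mulVKg u') invgM invgK.
Qed.

Lemma quo_mulA : associative quo_mul.
Proof.
move=> p q r; have [u <-] := quo_surj p; have [v <-] := quo_surj q.
have [w <-] := quo_surj r.
by rewrite !quo_mulE mulgA.
Qed.

Lemma quo_mul1 : left_id quo_one quo_mul.
Proof. by move=> p; have [u <-] := quo_surj p; rewrite quo_mulE mul1g. Qed.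

Lemma quo_mulr1 : right_id quo_one quo_mul.
Proof. by move=> p; have [u <-] := quo_surj p; rewrite quo_mulE mulg1. Qed.

Lemma quo_mulV : left_inverse quo_one quo_inv quo_mul.
Proof.
by move=> p; have [u <-] := quo_surj p; rewrite quo_invE quo_mulE mulVg.
Qed.

Lemma quo_mulrV : right_inverse quo_one quo_inv quo_mul.
Proof.
by move=> p; have [u <-] := quo_surj p; rewrite quo_invE quo_mulE mulgV.
Qed.

HB.instance Definition _ :=
  isGroup.Build quo quo_mulA quo_mul1 quo_mulr1 quo_mulV quo_mulrV.

Lemma quo_piM : {morph quo_pi : u v / u * v}.
Proof. by move=> u v; rewrite -quo_mulE. Qed.

HB.instance Definition _ := isMultiplicative.Build F quo quo_pi quo_piM.

Lemma quo_pi_eq1 u : (quo_pi u == 1) = (u \in N).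
Proof.
apply/eqP/idP => [/esym/quo_piP | Nu]; first by rewrite invg1 mul1g.
by apply/esym/quo_piP; rewrite invg1 mul1g.
Qed.

End Quotient.

HB.instance Definition _ (N : normalSubgroup F2) := Countable.on (quo N).

Definition isomorphic_to (Q : groupType) (gT : finGroupType) (G : {group gT})
    : Prop :=
  exists f : {multiplicative Q -> gT},
    injective f /\ (forall g, g \in G <-> exists q, f q = g).

Lemma F2_eval_gen (gT : finGroupType) (a b g : gT) :
  g \in <<[set a; b]>> <-> exists w, F2_eval a b w = g.
Proof.
split=> [|[w <-]].
  have gS : group_set [set g | `[< exists w, F2_eval a b w = g >]].
    apply/group_setP; split; first by rewrite inE; apply/asboolP; exists 1.
    move=> h k; rewrite !inE => /asboolP[u <-] /asboolP[v <-].
    by apply/asboolP; exists (u * v); rewrite F2_evalM.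
  have sS : <<[set a; b]>> \subset Group gS.
    rewrite gen_subG; apply/subsetP => h; rewrite !inE.
    case/orP=> /eqP->; apply/asboolP; first by exists F2x; rewrite F2_evalx.
    by exists F2y; rewrite F2_evaly.
  by move/(subsetP sS); rewrite inE => /asboolP.
rewrite /F2_eval; elim: (val w) => [|[i e] u IHu] /=.
  exact: group1.
rewrite groupM // /eval_letter /=.
by case: i e => [] [] /=; rewrite ?groupV mem_gen // !inE eqxx ?orbT.
Qed.

Section Gbar.

Variables (gT : finGroupType) (G : {group gT}).

(* N_G; the intersection of the empty family is F2. *)
Definition NG_pred : {pred F2} := fun w =>
  `[< forall N : normalSubgroup F2, isomorphic_to (quo N) G -> w \in N >].

Lemma NG_subproof1 : 1 \in NG_pred.
Proof. by apply/asboolP => N _; apply: nsub1. Qed.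

Lemma NG_subproofM u v : u \in NG_pred -> v \in NG_pred -> u * v \in NG_pred.
Proof.
by move=> /asboolP Nu /asboolP Nv; apply/asboolP => N isoN; apply: nsubM; auto.
Qed.

Lemma NG_subproofV u : u \in NG_pred -> u^-1 \in NG_pred.
Proof.
by move=> /asboolP Nu; apply/asboolP => N isoN; apply: nsubV; auto.
Qed.

Lemma NG_subproofJ u v : u \in NG_pred -> u ^ v \in NG_pred.
Proof.
by move=> /asboolP Nu; apply/asboolP => N isoN; apply: nsubJ; auto.
Qed.

Definition NG : normalSubgroup F2 :=
  NormalSubgroup NG_subproof1 NG_subproofM NG_subproofV NG_subproofJ.

Definition F2_onto (a b : gT) := G :==: <<[set a; b]>>.

Lemma mem_NGP w :
  reflect (forall a b, F2_onto a b -> F2_eval a b w = 1) (w \in NG).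
Proof.
rewrite -[w \in NG]/(NG_pred w) /NG_pred.
apply: (iffP (asboolP _)) => [Nw a b /eqP defG | Nw N [f [f_inj f_im]]].
  pose K : {pred F2} := fun u => F2_eval a b u == 1.
  have KE u : (u \in K) = (F2_eval a b u == 1) by [].
  have K1 : 1 \in K by rewrite KE.
  have KM u v : u \in K -> v \in K -> u * v \in K.
    by rewrite !KE F2_evalM => /eqP-> /eqP->; rewrite mulg1.
  have KV u : u \in K -> u^-1 \in K.
    by rewrite !KE F2_evalV => /eqP->; rewrite invg1.
  have KJ u v : u \in K -> u ^ v \in K.
    rewrite !KE conjgE !F2_evalM F2_evalV => /eqP->.
    by rewrite mul1g mulVg.
  pose NK := NormalSubgroup K1 KM KV KJ.
  suff /Nw : isomorphic_to (quo NK) G by rewrite KE => /eqP.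
  pose f (q : quo NK) := F2_eval a b (repr q).
  have fpi u : f (quo_pi NK u) = F2_eval a b u.
    rewrite /f; set v := repr _.
    have : v^-1 * u \in NK by apply/quo_piP; rewrite /quo_pi reprK.
    rewrite KE F2_evalM F2_evalV => /eqP vu1.
    by rewrite -[LHS]mulg1 -vu1 mulKVg.
  have fM : {morph f : p q / p * q}.
    move=> p q; have [[u <-] [v <-]] := (quo_surj p, quo_surj q).
    by rewrite -quo_piM !fpi F2_evalM.
  pose mf := isMultiplicative.Build _ _ f fM.
  pose F : {multiplicative quo NK -> gT} := HB.pack f mf.
  exists F; split=> [p q | g].
    have [[u <-] [v <-]] := (quo_surj p, quo_surj q); rewrite /= !fpi => uv.
    by apply/quo_piP; rewrite KE F2_evalM F2_evalV uv mulVg.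
  rewrite defG; split=> [/F2_eval_gen[u <-] | [q <-]].
    by exists (quo_pi NK u); rewrite /= fpi.
  have [u <-] := quo_surj q; rewrite /= fpi.
  by apply/F2_eval_gen; exists u.
pose h : {multiplicative F2 -> gT} := f \o @quo_pi _ N.
have hE : h =1 F2_eval (h F2x) (h F2y) by apply: F2_eval_unique.
have f1 : f 1 = 1 by apply: (mulgI (f 1)); rewrite -gmulfM !mulg1.
rewrite -quo_pi_eq1; apply/eqP/f_inj; rewrite f1 -[LHS]/(h w) hE.
apply: Nw; apply/eqP/setP => g; apply/idP/idP.
  case/f_im => q <-; have [u <-] := quo_surj q.
  by apply/F2_eval_gen; exists u; rewrite -hE.
case/F2_eval_gen=> u <-; rewrite -hE; apply/f_im.
by exists (quo_pi N u).
Qed.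

Definition Gbar_type := quo NG.

HB.instance Definition _ := Group.on Gbar_type.
HB.instance Definition _ := Countable.on Gbar_type.

(* F2 / N_G embeds into a finite power of G, hence is finite. *)
Definition Gbar_embed (q : Gbar_type) : {ffun gT * gT -> gT} :=
  [ffun ab => if F2_onto ab.1 ab.2 then F2_eval ab.1 ab.2 (repr q) else 1].

Lemma Gbar_embed_inj : injective Gbar_embed.
Proof.
move=> p q /ffunP epq; rewrite -[p]reprK -[q]reprK; apply/(quo_piP NG).
apply/mem_NGP => a b ab; have := epq (a, b); rewrite !ffunE /= ab.
by rewrite F2_evalM F2_evalV => ->; rewrite mulVg.
Qed.

Definition Gbar_unembed (t : {ffun gT * gT -> gT}) : option Gbar_type :=
  if pselect (exists q, Gbar_embed q == t) is left ex then Some (xchoose ex)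
  else None.

Lemma Gbar_embedK : pcancel Gbar_embed Gbar_unembed.
Proof.
move=> q; rewrite /Gbar_unembed; case: pselect => [ex|[]]; last by exists q.
by congr Some; apply: Gbar_embed_inj; apply/eqP; apply: (xchooseP ex).
Qed.

HB.instance Definition _ : isFinite Gbar_type := PCanIsFinite Gbar_embedK.

Definition Gbar : finGroupType := Gbar_type.

Definition gx : Gbar := quo_pi NG F2x.
Definition gy : Gbar := quo_pi NG F2y.

(* The automorphism of Gbar with x |-> a and y |-> b; the value when there is
   none is irrelevant. *)
Definition aut_xy (a b : Gbar) : {perm Gbar} :=
  odflt 1 [pick s in Aut [set: Gbar] | (s gx == a) && (s gy == b)].

Lemma gen_gxy : <<[set gx; gy]>> = [set: Gbar].
Proof.
apply/eqP; rewrite eqEsubset subsetT; apply/subsetP => q _.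
have [u <-] := quo_surj q; pose h : {multiplicative F2 -> Gbar} := @quo_pi _ NG.
by apply/F2_eval_gen; exists u; rewrite -(F2_eval_unique (f := h)).
Qed.

Lemma F2_eval_comp (H : groupType) (a b : H) u v w :
  F2_eval a b (F2_eval u v w) = F2_eval (F2_eval a b u) (F2_eval a b v) w.
Proof.
pose h : {multiplicative F2 -> H} := F2_eval a b \o F2_eval u v.
by rewrite -[LHS]/(h w); apply: F2_eval_unique;
  rewrite /h /= ?F2_evalx ?F2_evaly.
Qed.

Lemma F2_eval_id w : F2_eval F2x F2y w = w.
Proof.
pose h : {multiplicative F2 -> F2} := idfun.
by rewrite -(F2_eval_unique (f := h)).
Qed.

Section InducedAutomorphism.

Variables u v u' v' : F2.
Hypotheses (uvx : F2_eval u v u' = F2x) (uvy : F2_eval u v v' = F2y).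

Lemma F2_eval_NG w : w \in NG -> F2_eval u v w \in NG.
Proof.
move/mem_NGP=> Nw; apply/mem_NGP => a b /eqP defG.
rewrite F2_eval_comp; apply: Nw; apply/eqP/setP => g; rewrite defG.
apply/idP/idP => /F2_eval_gen[w' <-]; apply/F2_eval_gen.
  by exists (F2_eval u' v' w'); rewrite -F2_eval_comp
    [F2_eval u v _]F2_eval_comp uvx uvy F2_eval_id.
by exists (F2_eval u v w'); rewrite F2_eval_comp.
Qed.

Definition ind_map (q : Gbar_type) : Gbar_type := quo_pi NG (F2_eval u v (repr q)).

Lemma ind_mapE w : ind_map (quo_pi NG w) = quo_pi NG (F2_eval u v w).
Proof.
apply/quo_piP; rewrite -F2_evalV -F2_evalM; apply: F2_eval_NG.
by apply/quo_piP; rewrite /quo_pi reprK.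
Qed.

End InducedAutomorphism.

Lemma aut_xyP u v u' v' :
    F2_eval u v u' = F2x -> F2_eval u v v' = F2y ->
    F2_eval u' v' u = F2x -> F2_eval u' v' v = F2y ->
  let s := aut_xy (quo_pi NG u) (quo_pi NG v) in
  [/\ s \in Aut [set: Gbar], s gx = quo_pi NG u & s gy = quo_pi NG v].
Proof.
move=> uvx uvy uvx' uvy' s.
have fE := ind_mapE uvx uvy; have gE := ind_mapE uvx' uvy'.
have fK : cancel (ind_map u v) (ind_map u' v').
  move=> q; have [w <-] := quo_surj q.
  by rewrite fE gE F2_eval_comp uvx' uvy' F2_eval_id.
have fM : {morph ind_map u v : p q / p * q}.
  move=> p q; have [w <-] := quo_surj p; have [w' <-] := quo_surj q.
  by rewrite -quo_piM !fE F2_evalM quo_piM.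
rewrite /s /aut_xy; case: pickP => [t /and3P[At /eqP tx /eqP ty] // | noaut].
have := noaut (perm (can_inj fK)); rewrite !permE /gx /gy !fE F2_evalx F2_evaly.
rewrite !eqxx !andbT inE => /negP[]; apply/andP; split.
  by apply/subsetP => q; rewrite inE.
by apply/morphicP => p q _ _; rewrite !permE fM.
Qed.

Definition theta := aut_xy gy gx.
Definition delta := aut_xy (gy^-1 * gx^-1) gy.

Lemma thetaP :
  [/\ theta \in Aut [set: Gbar], theta gx = gy & theta gy = gx].
Proof.
by apply: (aut_xyP (u' := F2y) (v' := F2x)); rewrite ?F2_evalx ?F2_evaly.
Qed.

Lemma deltaP :
  [/\ delta \in Aut [set: Gbar], delta gx = gy^-1 * gx^-1 & delta gy = gy].
Proof.
have pV w : quo_pi NG w^-1 = (quo_pi NG w)^-1 by rewrite -quo_invE.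
have -> : gy^-1 * gx^-1 = quo_pi NG (F2y^-1 * F2x^-1) by rewrite quo_piM !pV.
rewrite /delta -[gy^-1]pV -[gx^-1]pV -quo_piM.
apply: (aut_xyP (u' := F2x^-1 * F2y^-1) (v' := F2y));
  by rewrite ?F2_evalM ?F2_evalV ?F2_evalx ?F2_evaly // invgM !invgK
    ?mulgK ?mulKg.
Qed.

End Gbar.

Section Out.

Variables (gT : finGroupType) (G : {group gT}).

Definition Inn : {set {perm gT}} := conj_aut G @* G.
Canonical Inn_group := [group of Inn].

Lemma Inn_normal : Inn <| Aut G.
Proof.
rewrite /normal Aut_conj_aut; apply/subsetP => s As; rewrite inE.
apply/subsetP => _ /imsetP[_ /morphimP[g NGg Gg ->] ->].
have sG h : h \in G -> s h \in G by move=> Gh; rewrite Aut_closed.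
have sVG h : h \in G -> s^-1 h \in G.
  by move=> Gh; rewrite Aut_closed // groupV.
apply/morphimP; exists (s g); rewrite ?(subsetP (normG G)) ?sG //.
have Acg : conj_aut G g \in Aut G.
  by apply: (subsetP (Aut_conj_aut G G)); apply: mem_morphim.
apply: (eq_Aut (A := G)); rewrite ?groupJ //.
  by apply: (subsetP (Aut_conj_aut G G)); apply: mem_morphim;
    rewrite ?(subsetP (normG G)) ?sG.
move=> h Gh; rewrite conjgE !permM !conj_autE ?sVG ?sG //.
have {2}-> : h = s (s^-1 h) by rewrite permKV.
rewrite -!(autmE As) morphJ ?sVG //.
Qed.

Definition Out : {set coset_of Inn} := Aut G / Inn.
Canonical Out_group := [group of Out].

End Out.

Section GT1.

Variables (gT : finGroupType) (G : {group gT}).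

Local Notation Gb := [set: Gbar G]%G.
Local Notation class_of := (coset (Inn Gb)).

Definition GT1_aut : {set {perm Gbar G}} :=
  [set phi in Aut Gb | [&& phi (gx G) \in gx G ^: Gb,
     class_of phi \in 'C[class_of (theta G)] &
     class_of phi \in 'C[class_of (delta G)]]].

Lemma GT1_group_set : group_set GT1_aut.
Proof.
have nA := subsetP (normal_norm (Inn_normal Gb)).
apply/group_setP; split.
  have c1 : class_of 1 = 1 by exact: morph1.
  apply/setIdP; split; first exact: group1.
  by rewrite perm1 class_refl c1 /=; apply/andP; split; apply/cent1P; apply: commute_sym; apply: commute1.
move=> s t /setIdP[As /and3P[sx sth sd]] /setIdP[At /and3P[tx tth td]].
have [nIs nIt] := (nA _ As, nA _ At).
have cM : class_of (s * t) = class_of s * class_of t by exact: morphM.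
apply/setIdP; split; first exact: groupM.
rewrite cM (groupM sth tth) (groupM sd td) !andbT permM.
case/imsetP: sx => g _ ->; rewrite -(autmE At) morphJ ?in_setT //= autmE.
by case/imsetP: tx => h _ ->; rewrite -conjgM memJ_class ?in_setT.
Qed.

Canonical GT1_aut_group := Group GT1_group_set.

Definition GT1 : {set coset_of (Inn Gb)} := GT1_aut / Inn Gb.
Canonical GT1_group := [group of GT1].

End GT1.

(* Main.v *)
Require Import Defs.
From HB Require Import structures.
From mathcomp Require Import all_boot all_order all_algebra all_fingroup.
From mathcomp Require Import all_solvable integral_char.
From mathcomp Require Import boolp.

(* Let X be the set of pairs generating G, up to conjugation by G. By Goursat's
   lemma, Gbar is the group of all Aut(G)-equivariant functions from generating
   pairs to G, so that Out(Gbar) is the group of all permutations of X that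
   commute with Out(G). Hence GT_1(G) is the group of the permutations of X that
   commute with a group H, generated by the images of Out(G), theta and delta,
   and that preserve the conjugacy classes of both members of a pair. Since G
   acts freely on generating pairs, at most m^2/|G| points of X share the same
   two classes.

   Such a permutation group acts on the set of H-orbits of X. If it maps an
   orbit to another one it also contains an involution that exchanges just
   these two, so it induces the full symmetric group on each set of orbits that
   it permutes transitively: this contributes C_2, C_3 and alternating groups of
   degree at most m^2/|G|. The kernel of this action commutes with H and
   preserves each H-orbit, so it is an iterated extension of subquotients of H.
   Finally H is an extension of a quotient of S_3 by a quotient of Out(G). *)

Set Implicit Arguments.
Unset Strict Implicit.
Unset Printing Implicit Defensive.

Local Open Scope group_scope.

(** * Simple sections and composition factors *)

Section IsogSections.

Variables (aT rT : finGroupType) (D : {group aT}) (f : {morphism D >-> rT}).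
Implicit Types A L : {group aT}.

Lemma morphim_quotient_isog A L :
  A \subset D -> L <| A -> 'ker_A f \subset L -> A / L \isog f @* A / f @* L.
Proof.
move=> sAD nsLA sKL; pose g := restrm sAD f.
have gE (B : {group aT}) : B \subset A -> g @* B = f @* B.
  by move=> sBA; rewrite morphim_restrm (setIidPr sBA).
rewrite -(gE A) // -(gE L) ?normal_sub //.
apply/isogP; exists (quotm_morphism g nsLA); last exact: morphim_quotm.
by rewrite ker_quotm ker_restrm; apply/trivgP/quotientS1.
Qed.

(** The image of ['ker_A f] in the simple group [A / L] is trivial or everything: either [f]
    preserves the quotient or the kernel already covers it. *)
Lemma simple_quotient_morphim A L : A \subset D -> L <| A -> simple (A / L) ->
  A / L \isog f @* A / f @* L \/
  A / L \isog 'ker_A f / (L :&: 'ker_A f).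
Proof.
move=> sAD nsLA simAL; have nLA := normal_norm nsLA.
have sKA : 'ker_A f \subset A by apply: subsetIl.
have nsK : 'ker_A f / L <| A / L.
  apply: quotient_normal; rewrite /normal sKA.
  by rewrite normsI ?normG // (subset_trans sAD) // ker_norm.
have [_ /(_ _ nsK)[/trivgP K1|KA]] := simpleP _ simAL.
  left; apply: morphim_quotient_isog => //.
  by rewrite -quotient_sub1 // (subset_trans sKA).
right; rewrite -KA isog_sym.
exact: second_isog (subset_trans sKA nLA).
Qed.

End IsogSections.

Section SimpleFactors.

Variable Pr : forall gT : finGroupType, {group gT} -> Prop.
Hypothesis Pr_isog : forall (aT rT : finGroupType)
  (A : {group aT}) (B : {group rT}), A \isog B -> Pr A -> Pr B.

(** [Pr] stands for the list of groups allowed by the theorem. Sections pass to subgroups; in a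
    symmetric group only subnormal [A] can be controlled, because alternating groups have many other
    simple sections. *)
Definition simple_sections_in (gT : finGroupType) (G : {group gT}) :=
  forall A L : {group gT},
    A \subset G -> L <| A -> simple (A / L) -> Pr (A / L)%G.

Definition simple_factors_in (gT : finGroupType) (G : {group gT}) :=
  forall A L : {group gT},
    A <|<| G -> L <| A -> simple (A / L) -> Pr (A / L)%G.

Lemma simple_sections_factors gT (G : {group gT}) :
  simple_sections_in G -> simple_factors_in G.
Proof. by move=> secG A L /subnormal_sub; apply: secG. Qed.

Lemma simple_sectionsS gT (G H : {group gT}) :
  H \subset G -> simple_sections_in G -> simple_sections_in H.
Proof. by move=> sHG secG A L sAH; apply/secG/(subset_trans sAH). Qed.

Section Morphism.

Variables (aT rT : finGroupType) (D G : {group aT}).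
Variable f : {morphism D >-> rT}.
Hypothesis sGD : G \subset D.

Lemma simple_sections_morphim :
  simple_sections_in G -> simple_sections_in (f @* G).
Proof.
move=> secG A L sAfG nsLA simAL; have [sLA nLA] := andP nsLA.
pose pre (B : {group rT}) := (G :&: f @*^-1 B)%G.
have fpre (B : {group rT}) : B \subset f @* G -> f @* (pre B) = B.
  by move=> /setIidPr; rewrite -morphim_setIpre.
have sAD : pre A \subset D by rewrite subIset ?sGD.
have nspre : pre L <| pre A.
  rewrite /normal setIS ?morphpreS //=; apply/subsetP=> g /setIP[Gg].
  move=> Ag; rewrite inE conjIg (conjGid Gg) setIS //.
  have [Dg] := morphpreP Ag.
  by move=> /(subsetP nLA) nLg; rewrite -morphpreJ // (normP nLg).
have skL : 'ker_(pre A) f \subset pre L.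
  by apply/subsetP=> g /setIP[/setIP[Gg _] /(subsetP (ker_sub_pre f L)) Lg];
    apply/setIP.
have iso : pre A / pre L \isog A / L.
  have := morphim_quotient_isog sAD nspre skL.
  by rewrite (fpre A) // (fpre L) ?(subset_trans sLA).
apply: (Pr_isog (A := (pre A / pre L)%G)) => //.
apply: secG => //; first exact: subsetIl.
by have /= -> := isog_simple iso.
Qed.

Lemma simple_sections_ext : simple_sections_in ('ker_G f) ->
  simple_sections_in (f @* G) -> simple_sections_in G.
Proof.
move=> secK secfG A L sAG nsLA simAL.
have sAD := subset_trans sAG sGD.
have [iso|iso] := simple_quotient_morphim f sAD nsLA simAL.
  rewrite isog_sym in iso; apply: (Pr_isog iso).
  apply: secfG; rewrite ?morphimS ?morphim_normal //.
  by rewrite (isog_simple iso).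
rewrite isog_sym in iso; apply: (Pr_isog iso); apply: secK.
- exact: setSI.
- by rewrite /= setIC; apply: normalGI (subsetIl _ _) nsLA.
by rewrite (isog_simple iso).
Qed.

Lemma simple_factors_ext : simple_factors_in ('ker_G f) ->
  simple_factors_in (f @* G) -> simple_factors_in G.
Proof.
move=> facK facfG A L snAG nsLA simAL; have sAG := subnormal_sub snAG.
have sAD := subset_trans sAG sGD.
have [iso|iso] := simple_quotient_morphim f sAD nsLA simAL.
  rewrite isog_sym in iso; apply: (Pr_isog iso).
  apply: facfG; rewrite ?morphim_subnormal ?morphim_normal //.
  by rewrite (isog_simple iso).
rewrite isog_sym in iso; apply: (Pr_isog iso); apply: facK.
- have := setI_subnormal (subsetIl G ('ker f)) snAG.
  by rewrite /= setIA (setIidPl sAG).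
- by rewrite /= setIC; apply: normalGI (subsetIl _ _) nsLA.
by rewrite (isog_simple iso).
Qed.

End Morphism.

Hypothesis Pr23 : forall (gT : finGroupType) (G : {group gT}),
  #|G| = 2 \/ #|G| = 3 -> Pr G.

(** At most two primes divide the order, so Burnside's theorem makes the group solvable and its
    simple sections have order 2 or 3. The number 24 is the order of the symmetric group of degree
    4. *)
Lemma simple_sections_dvd24 gT (G : {group gT}) :
  #|G| %| 24 -> simple_sections_in G.
Proof.
move=> dvG A L sAG nsLA simAL.
have solG : solvable G.
  apply: Burnside_p_a_q_b; apply: (@leq_trans (size (primes 24))) => //.
  apply: uniq_leq_size (primes_uniq _) _ => p.
  rewrite !mem_primes => /and3P[p_pr _ dvp].
  by rewrite p_pr (dvdn_trans dvp).
have: prime #|A / L|.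
  by apply: simple_sol_prime => //; apply/quotient_sol/(solvableS sAG).
have: #|A / L| %| 24.
  apply: dvdn_trans dvG; apply: dvdn_trans (cardSg sAG).
  exact: dvdn_quotient.
move=> /= dv pr; apply: Pr23 => /=.
have: #|A / L| \in primes 24 by rewrite mem_primes pr dv.
by rewrite !inE => /orP[] /eqP; [left|right].
Qed.


Lemma simple_factors_simple gT (G : {group gT}) :
  simple G -> Pr G -> simple_factors_in G.
Proof.
move=> simG PrG A L snAG nsLA simAL.
have [ntAL _] := simpleP _ simAL; have [_ normG] := simpleP _ simG.
have [defA | [K [/subnormal_sub sAK nsKG prKG]]] := subnormalEr snAG.
  rewrite (group_inj defA) in nsLA ntAL *.
  have [/group_inj L1 | /group_inj LG] := normG _ nsLA; last first.
    by rewrite LG /= trivg_quotient eqxx in ntAL.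
  by rewrite L1; apply: Pr_isog PrG; apply: quotient1_isog.
have [K1|KG] := normG _ nsKG; last by rewrite KG properxx in prKG.
rewrite K1 in sAK; have /= A1 := trivgP sAK.
by rewrite /= A1 quotient1 eqxx in ntAL.
Qed.

Lemma simple_factors_Sym (T : finType) :
  (4 < #|T| -> Pr 'Alt_T) -> simple_factors_in 'Sym_T.
Proof.
move=> PrA; have [cT|] := leqP #|T| 4.
  apply/simple_sections_factors/simple_sections_dvd24; rewrite card_Sym.
  by case: #|T| cT => [|[|[|[|[]]]]].
move=> cT; apply: (simple_factors_ext (f := sign_morph T)) => //.
  have -> : ('ker_('Sym_T) (sign_morph T))%G = 'Alt_T%G.
    by apply/group_inj; rewrite /= setTI.
  by apply: simple_factors_simple; [apply: simple_Alt5 | apply: PrA].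
apply/simple_sections_factors/simple_sections_dvd24.
have : #|sign_morph T @* 'Sym_T| <= 2.
  by rewrite -card_bool; apply: max_card.
by have := cardG_gt0 (sign_morph T @* 'Sym_T); case: #|_| => [|[|[]]].
Qed.

End SimpleFactors.

(** * Groups of permutations *)

Section PermRank.

Variable T : finType.
Implicit Types s t : {perm T}.

Fact perm_rank_inj s :
  injective (fun i : 'I_#|T| => enum_rank (s (enum_val i))).
Proof. by move=> i j /enum_rank_inj/perm_inj/enum_val_inj. Qed.

(** Relabels the points by ordinals, since the theorem speaks of ['Alt_('I_r)]. *)
Definition perm_rank s : {perm 'I_#|T|} := perm (@perm_rank_inj s).

Lemma perm_rankM : {in [set: {perm T}] &, {morph perm_rank : s t / s * t}}.
Proof.
by move=> s t _ _; apply/permP=> i; rewrite permM !permE /= enum_rankK.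
Qed.

Canonical perm_rank_morphism := Morphism perm_rankM.

Lemma injm_perm_rank : 'injm perm_rank.
Proof.
apply/injmP=> s t _ _ /permP est; apply/permP=> x.
by have := est (enum_rank x); rewrite !permE enum_rankK => /enum_rank_inj.
Qed.

Lemma im_perm_rank : perm_rank @* [set: {perm T}] = [set: {perm 'I_#|T|}].
Proof.
apply/eqP; rewrite eqEcard subsetT card_injm ?injm_perm_rank //.
by rewrite [leqLHS](card_Sym 'I_#|T|) [leqRHS](card_Sym T) card_ord leqnn.
Qed.

End PermRank.

Section TranspositionGroups.

Variable Pr : forall gT : finGroupType, {group gT} -> Prop.
Hypothesis Pr_isog : forall (aT rT : finGroupType)
  (A : {group aT}) (B : {group rT}), A \isog B -> Pr A -> Pr B.
Hypothesis Pr23 : forall (gT : finGroupType) (G : {group gT}),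
  #|G| = 2 \/ #|G| = 3 -> Pr G.

(* B restricts to the full symmetric group of an orbit C, and the elements of B
   that fix C pointwise satisfy the same hypotheses as B. *)
Lemma simple_factors_tperm (Z : finType) (B : {group {perm Z}}) k :
    (forall b z, b \in B -> tperm z (b z) \in B) ->
    (forall z, #|orbit 'P B z| <= k) ->
    (forall r, 4 < r -> r <= k -> Pr 'Alt_('I_r)) ->
  simple_factors_in Pr B.
Proof.
move=> tB kB PrA; move: {2}_.+1 (ltnSn #|B|) => n.
elim: n => // n IHn in B tB kB *; rewrite ltnS => leBn.
have [/trivgP B1|] := boolP (B \subset [1]).
  apply: (@simple_sections_factors Pr); apply: simple_sections_dvd24 => //.
  by rewrite B1 cards1.
case/subsetPn=> b0 Bb0 /set1P ntb0.
have [z0 b0z0] : exists z, b0 z != z.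
  apply/existsP; apply: contra_notT ntb0 => /existsPn fixb.
  by apply/permP=> z; rewrite perm1; apply/eqP/negPn/fixb.
pose C := orbit 'P B z0.
pose sT := {z | z \in C}.
pose f := actperm ('P^? : action _ sT)%act.
have nCB : B \subset subact_dom (mem C) 'P%act.
  have -> : subact_dom (mem C) 'P%act = 'N(C | 'P).
    by rewrite /subact_dom; congr 'N(_ | _); apply/setP=> z; rewrite inE.
  by rewrite acts_orbit ?subsetT.
have fE b (z : sT) : b \in B -> val (f b z) = b (val z).
  by move=> Bb; rewrite actpermE val_subact (subsetP nCB).
have kerfP b : reflect (b \in B /\ {in C, forall z, b z = z}) (b \in 'ker_B f).
  apply: (iffP setIP) => -[Bb].
    rewrite ker_actperm astab_subact => /setIP[_ /astabP cb].
    split=> // z Cz.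
    by apply: (cb z); apply/imsetP; exists (exist _ z Cz).
  move=> cb; split=> //; rewrite ker_actperm astab_subact inE (subsetP nCB) //.
  by apply/astabP => _ /imsetP[z _ ->]; apply: cb; apply: valP.
have nfix b z : b \in B -> (b z \in C) = (z \in C).
  by move=> Bb; rewrite -[b z]apermE /C (actsP (acts_orbit _ _ (subsetT _))).
(* The transpositions of [x0] with the points of its orbit come from [B] by hypothesis, and they
   generate the symmetric group of the orbit. *)
have imf : f @* B = [set: {perm sT}].
  have x0 : sT by exists z0; apply: orbit_refl.
  apply/eqP; rewrite eqEsubset subsetT -(gen_tperm x0) gen_subG.
  apply/subsetP=> _ /imsetP[y _ ->].
  have [b Bb by0] : exists2 b, b \in B & b (val x0) = val y.
    by have /orbitP[b Bb] : val y \in orbit 'P B (val x0);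
      [rewrite (orbit_eqP (valP x0)) (valP y) | exists b].
  have Bt : tperm (val x0) (val y) \in B by rewrite -by0 tB.
  suff -> : tperm x0 y = f (tperm (val x0) (val y)).
    by apply: mem_morphim => //; apply: (subsetP nCB).
  apply/permP=> z; apply: val_inj; rewrite fE //.
  by case: tpermP => [->|->|/eqP zx /eqP zy];
    rewrite ?tpermL ?tpermR ?tpermD // eq_sym.
apply: (simple_factors_ext Pr_isog nCB (f := f)).
  apply: IHn => [b z /kerfP[Bb cb]|z|].
  - apply/kerfP; split=> [|w Cw]; first exact: tB.
    have [Cz|nCz] := boolP (z \in C); first by rewrite cb // tperm1 perm1.
    rewrite tpermD //; apply: contraNneq nCz; first by move->.
    by rewrite -(nfix b) // => ->.
  - apply: leq_trans (kB z); apply/subset_leq_card/imsetS.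
    exact: subsetIl.
  - apply: leq_trans leBn; apply/proper_card/properP; split.
      exact: subsetIl.
    exists b0 => //; apply/kerfP => -[_ cb].
    by move: b0z0; rewrite cb ?eqxx ?orbit_refl.
have -> : (f @* B)%G = 'Sym_sT%G by apply/group_inj; exact: imf.
apply: (simple_factors_ext Pr_isog (f := @perm_rank_morphism sT)) => //.
  apply: (@simple_sections_factors Pr); apply: simple_sections_dvd24 => //.
  have /trivgP := injm_perm_rank sT; rewrite /= => -> /=.
  by rewrite (setIidPr (sub1G _)) cards1.
have -> : (perm_rank_morphism sT @* 'Sym_sT)%G = 'Sym_('I_#|{: sT}|)%G.
  by apply/group_inj; exact: im_perm_rank.
apply: (simple_factors_Sym Pr_isog Pr23); rewrite card_ord => cT.
by apply: PrA => //; rewrite card_sig; apply: kB.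
Qed.

End TranspositionGroups.

(** * Permutation groups that centralize a given group *)

Section Centralizers.

Variable Pr : forall gT : finGroupType, {group gT} -> Prop.
Hypothesis Pr_isog : forall (aT rT : finGroupType)
  (A : {group aT}) (B : {group rT}), A \isog B -> Pr A -> Pr B.
Hypothesis Pr23 : forall (gT : finGroupType) (G : {group gT}),
  #|G| = 2 \/ #|G| = 3 -> Pr G.

Lemma cent_permE (X : finType) (H : {group {perm X}}) (g : {perm X}) :
  reflect (forall h x, h \in H -> g (h x) = h (g x)) (g \in 'C(H)).
Proof.
apply: (iffP centP) => [cg h x Hh | cg h Hh].
  by rewrite -!permM cg.
by apply/permP=> x; rewrite !permM cg.
Qed.

(* R is a subgroup of H x D that projects onto D; the kernel of its projection
   to H embeds into D0. *)
Lemma simple_sections_rel (aT rT : finGroupType) (H : {group aT})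
    (D D0 : {group rT}) (R : aT -> rT -> bool) :
    R 1 1 ->
    (forall h h' d d', h \in H -> h' \in H -> d \in D -> d' \in D ->
       R h d -> R h' d' -> R (h * h') (d * d')) ->
    (forall d, d \in D -> exists2 h, h \in H & R h d) ->
    (forall d, d \in D -> R 1 d -> d \in D0) ->
    simple_sections_in Pr H -> simple_sections_in Pr D0 ->
  simple_sections_in Pr D.
Proof.
move=> R1 RM Rsurj R0 secH secD0.
pose E := [set u in setX H D | R u.1 u.2].
have EP h d : reflect [/\ h \in H, d \in D & R h d] ((h, d) \in E).
  by rewrite !inE -andbA; apply: and3P.
have gE : group_set E.
  apply/group_setP; split=> [|[h d] [h' d'] /EP[Hh Dd hd] /EP[Hh' Dd' hd']].
    by apply/EP; rewrite /= !group1.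
  by apply/EP; split; rewrite ?groupM ?RM.
have <- : (snd_morphism _ _ @* Group gE)%G = D.
  apply/group_inj/setP=> d; apply/morphimP/idP => [|Dd].
    by case=> [[h d'] _ /EP[_ Dd _] ->].
  have [h Hh hd] := Rsurj d Dd.
  by exists (h, d) => //; apply/EP.
apply: (simple_sections_morphim Pr_isog (subsetT _)).
apply: (simple_sections_ext Pr_isog (subsetT _) (f := fst_morphism _ _));
  last first.
  apply: simple_sectionsS secH.
  by apply/subsetP=> _ /morphimP[[h d] _ /EP[Hh _ _] ->].
apply: (@simple_sectionsS _ _ (pair1g_morphism aT rT @* D0)%G).
  apply/subsetP=> -[h d] /setIP[/EP[_ Dd hd] /mker /= h1].
  apply/morphimP; exists d; rewrite ?inE //= ?h1 //.
  by apply: R0 => //; rewrite -h1.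
exact: (simple_sections_morphim Pr_isog (subsetT _)).
Qed.

(** Induction on the order of [D]. For a moved point [x0], each [d] is matched with some [h] in [H],
    because [D] preserves the [H]-orbits; the elements matched with 1 fix [x0] and lie in a smaller
    group. *)
Lemma simple_sections_cent_perm (X : finType) (H D : {group {perm X}}) :
    D \subset 'C(H) -> (forall d x, d \in D -> d x \in orbit 'P H x) ->
  simple_sections_in Pr H -> simple_sections_in Pr D.
Proof.
move=> cD oD secH; move: {2}_.+1 (ltnSn #|D|) => n.
elim: n => // n IHn in D cD oD *; rewrite ltnS => leDn.
have [/trivgP D1|] := boolP (D \subset [1]).
  by apply: simple_sections_dvd24 => //; rewrite D1 cards1.
case/subsetPn=> d0 Dd0 /set1P ntd0.
have [x0 d0x0] : exists x, d0 x != x.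
  apply/existsP; apply: contra_notT ntd0 => /existsPn fixd.
  by apply/permP=> x; rewrite perm1; apply/eqP/negPn/fixd.
have cDE d h x : d \in D -> h \in H -> d (h x) = h (d x).
  by move=> Dd; have /cent_permE := subsetP cD d Dd; apply.
have cVDE d h x : d \in D -> h \in H -> d^-1 (h x) = h (d^-1 x).
  by move=> Dd; apply: cDE; rewrite groupV.
(* h x0 = d^-1 x0 is multiplicative in (h, d) because H and D commute. *)
apply: (@simple_sections_rel _ _ H D 'C_D[x0 | 'P]%G
          (fun h d => h x0 == d^-1 x0)).
- by rewrite invg1 eqxx.
- move=> h h' d d' Hh Hh' Dd Dd' /eqP hd /eqP hd'.
  by rewrite permM hd -cVDE // hd' invMg permM.
- move=> d Dd; have /orbitP[h Hh hd] := oD d^-1 x0 (groupVr Dd).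
  by exists h; rewrite // -hd.
- move=> d Dd; rewrite perm1 => /eqP x0d; apply/setIP; split=> //.
  by apply/astab1P; rewrite /= apermE {1}x0d permKV.
- exact: secH.
apply: IHn => [||].
- exact: subset_trans (subsetIl _ _) cD.
- by move=> d x /setIP[Dd _]; apply: oD.
apply: leq_trans leDn; apply/proper_card/properP; split; first exact: subsetIl.
exists d0 => //; apply: contra d0x0 => /setIP[_ /astab1P].
by rewrite /= apermE => ->.
Qed.

Section FiberPreserving.

Variables (X : finType) (Y : eqType) (T : X -> Y) (k : nat).
Variables H Gam : {group {perm X}}.
Hypothesis GamP : forall g,
  reflect (g \in 'C(H) /\ forall x, T (g x) = T x) (g \in Gam).
Hypothesis fib_le : forall x, #|[set x' | T x' == T x]| <= k.
Hypothesis secH : simple_sections_in Pr H.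
Hypothesis PrA : forall r, 4 < r -> r <= k -> Pr 'Alt_('I_r).

Let O x := orbit 'P H x.
Let Z := O @: [set: X].

Lemma orbit_setact g x : g \in Gam -> ('P^*)%act (O x) g = O (g x).
Proof.
case/GamP=> cg _; rewrite /O /= setact_orbit /= apermE (normP _) //.
by apply: subsetP cg; apply: cent_sub.
Qed.

Lemma orbits_acts : [acts Gam, on Z | 'P^*].
Proof.
apply/actsP=> g Gg S; apply/imsetP/imsetP => -[x _ defS]; last first.
  by exists (g x); rewrite ?inE // defS orbit_setact.
exists (g^-1 x); rewrite ?inE //.
by rewrite -orbit_setact ?groupV // -defS actK.
Qed.

(** This permutes all sets of points; [actby] makes it the identity on the sets that are not
    [H]-orbits. *)
Let f := actperm (<[orbits_acts]>)%act.

Lemma orbit_perm_orbit g x : g \in Gam -> f g (O x) = O (g x).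
Proof.
move=> Gg; rewrite actpermE actbyE ?orbit_setact //.
by apply: imset_f.
Qed.

Lemma orbit_perm_out g S : S \notin Z -> f g S = S.
Proof. by move=> nZ; rewrite actpermE /= /actby (negPf nZ). Qed.

Section Swap.
Variables (g : {perm X}) (x : X).
Hypotheses (Gg : g \in Gam) (ngx : g x \notin O x).

Let swap u := if u \in O x then g u else if u \in O (g x) then g^-1 u else u.

Let gO u : (g u \in O (g x)) = (u \in O x).
Proof. by rewrite -orbit_setact // /setact mem_imset //; apply: perm_inj. Qed.

Let gVO u : (g^-1 u \in O x) = (u \in O (g x)).
Proof. by rewrite -gO permKV. Qed.

Let O_disj u : u \in O x -> u \in O (g x) = false.
Proof.
move=> xu; apply: contraNF ngx => gu.
by rewrite /O -(orbit_eqP xu) (orbit_eqP gu) orbit_refl.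
Qed.

Lemma swap_inj : injective swap.
Proof.
apply: (@can_inj _ _ _ swap) => u; rewrite /swap.
have [xu|nxu] := boolP (u \in O x).
  have gu : g u \in O (g x) by rewrite gO.
  have [/O_disj|_] := boolP (g u \in O x); first by rewrite gu.
  by rewrite gu permK.
have [gu|ngu] := boolP (u \in O (g x)); first by rewrite gVO gu permKV.
by rewrite (negPf nxu) (negPf ngu).
Qed.

(** On each [H]-orbit the swap agrees with [g], [g^-1] or the identity, each of which commutes with
    [H] and preserves [T]. *)
Lemma mem_swap : perm swap_inj \in Gam.
Proof.
have [/cent_permE cg Tg] := GamP _ Gg.
have [/cent_permE cgV TgV] := GamP _ (groupVr Gg).
apply/GamP; split=> [|u]; last first.
  by rewrite permE /swap; case: ifP => _; [|case: ifP => _].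
have Oh h u y : h \in H -> (h u \in O y) = (u \in O y).
  by move=> Hh; rewrite -[h u]apermE orbit_actr.
by apply/cent_permE=> h Hh u; rewrite !permE /swap !Oh //;
  case: ifP => _; [|case: ifP => _]; rewrite ?cg ?cgV.
Qed.

Lemma orbit_perm_swap : f (perm swap_inj) = tperm (O x) (O (g x)).
Proof.
apply/permP=> S; have [/imsetP[u _ ->]|nZS] := boolP (S \in Z); last first.
  rewrite orbit_perm_out // tpermD //; apply: contraNneq nZS => <-;
    exact: imset_f.
rewrite orbit_perm_orbit ?mem_swap // permE /swap.
have [xu|nxu] := boolP (u \in O x).
  by rewrite /O (orbit_eqP xu) tpermL; apply/orbit_eqP; rewrite gO.
have [gu|ngu] := boolP (u \in O (g x)).
  by rewrite /O -(orbit_eqP gu) tpermR; apply/orbit_eqP; rewrite gVO.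
rewrite tpermD //; [apply: contraNneq nxu | apply: contraNneq ngu] => ->;
  exact: orbit_refl.
Qed.

End Swap.

(** The kernel of the action on orbits falls under [simple_sections_cent_perm], and the swaps bring
    the image under [simple_factors_tperm]. *)
Lemma simple_factors_cent_fibers : simple_factors_in Pr Gam.
Proof.
apply: (simple_factors_ext Pr_isog (f := f)) => //.
  apply: (@simple_sections_factors Pr).
  apply: simple_sections_cent_perm secH => [|d x].
    by apply/subsetP=> g /setIP[/GamP[]].
  case/setIP=> Gd /mker fd1.
  apply/orbit_eqP; apply: etrans (esym (orbit_perm_orbit x Gd)) _.
  by have /permP/(_ (O x)) := fd1; rewrite perm1.
(* The 1 accounts for the sets that are not [H]-orbits, each of which is fixed; it does not affect
   degrees above 4. *)
apply: (simple_factors_tperm Pr_isog Pr23 (k := maxn 1 k)).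
- move=> b S /morphimP[g _ Gg ->].
  have [/imsetP[x _ ->]|nZS] := boolP (S \in Z); last first.
    by rewrite orbit_perm_out // tperm1 group1.
  rewrite orbit_perm_orbit //; have [gx|ngx] := boolP (g x \in O x).
    by rewrite /O (orbit_eqP gx) tperm1 group1.
  by rewrite -(orbit_perm_swap Gg ngx) mem_morphim // mem_swap.
- move=> S; have [/imsetP[x _ ->]|nZS] := boolP (S \in Z); last first.
    apply: leq_trans (leq_maxl _ _); rewrite -(cards1 S).
    apply: subset_leq_card.
    apply/subsetP=> _ /orbitP[_ /morphimP[g _ _ ->] <-].
    by rewrite /= apermE orbit_perm_out // set11.
  (* The images of [O x] are the sets [O (g x)], and [g x] stays in the fiber of [T] through [x]. *)
  apply: leq_trans (leq_maxr _ _); apply: leq_trans (fib_le x).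
  apply: leq_trans (leq_imset_card O _); apply: subset_leq_card.
  apply/subsetP=> _ /orbitP[_ /morphimP[g _ Gg ->] <-].
  rewrite /= apermE orbit_perm_orbit //; apply: imset_f; rewrite inE.
  by have [_ ->] := GamP _ Gg.
by move=> r r4; rewrite leq_max leqNgt (ltn_trans _ r4) //=; apply: PrA.
Qed.

End FiberPreserving.
End Centralizers.

(** * Generating pairs *)

Section GeneratingPairs.

Variables (gT : finGroupType) (G : {group gT}).

Record gpair :=
  GPair { pair_of_gpair : gT * gT;
          _ : F2_onto G pair_of_gpair.1 pair_of_gpair.2 }.

HB.instance Definition _ := [isSub for pair_of_gpair].
HB.instance Definition _ := [Finite of gpair by <:].

Implicit Types (p : gpair) (q : Gbar G) (w : Defs.F2).

(** The homomorphism from [Gbar G] onto [G] that sends the two generators to the members of [p]; by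
    [ev_pi] any representative word gives the same value. *)
Definition ev p q : gT := Gbar_embed q (val p).

Lemma ev_pi p w : ev p (quo_pi (NG G) w) = F2_eval (val p).1 (val p).2 w.
Proof.
rewrite /ev ffunE (valP p).
set v := generic_quotient.repr _.
have : v^-1 * w \in NG G.
  by apply/quo_piP; rewrite /quo_pi generic_quotient.reprK.
move=> /mem_NGP/(_ _ _ (valP p)); rewrite F2_evalM F2_evalV => vw1.
by apply: (mulgI (F2_eval (val p).1 (val p).2 v)^-1); rewrite vw1 mulVg.
Qed.

Lemma ev_inj q q' : (forall p, ev p q = ev p q') -> q = q'.
Proof.
move=> eqq; apply: Gbar_embed_inj; apply/ffunP=> -[a b].
have [ab|nab] := boolP (F2_onto G a b).
  exact: (eqq (GPair (pair_of_gpair := (a, b)) ab)).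
by rewrite !ffunE /= (negPf nab).
Qed.

Lemma ev_x p : ev p (gx G) = (val p).1.
Proof. by rewrite ev_pi F2_evalx. Qed.

Lemma ev_y p : ev p (gy G) = (val p).2.
Proof. by rewrite ev_pi F2_evaly. Qed.

Lemma evM p : {morph ev p : q q' / q * q'}.
Proof.
move=> q q'; have [[w <-] [w' <-]] := (quo_surj q, quo_surj q').
by rewrite -quo_piM !ev_pi F2_evalM.
Qed.

Canonical ev_morphism p := @Morphism _ _ [set: Gbar G] _ (in2W (evM p)).

Lemma im_ev p : ev p @* [set: Gbar G] = G.
Proof.
have := morphim_gen (ev_morphism p) (subsetT [set gx G; gy G]).
rewrite gen_gxy => ->; rewrite (eqP (valP p)).
by rewrite morphimU !morphim_set1 ?inE //= ev_x ev_y.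
Qed.

Lemma mem_ev p q : ev p q \in G.
Proof.
have := mem_morphim (ev_morphism p) (in_setT q) (in_setT q).
by rewrite im_ev.
Qed.

Lemma ev_surj p g : g \in G -> exists q, ev p q = g.
Proof.
move=> Gg; have : g \in ev p @* [set: Gbar G] by rewrite im_ev.
by case/morphimP=> q _ _ ->; exists q.
Qed.

Lemma eq_morph_gxy (rT : finGroupType) (f h : Gbar G -> rT) :
    {morph f : q q' / q * q'} -> {morph h : q q' / q * q'} ->
  f (gx G) = h (gx G) -> f (gy G) = h (gy G) -> f =1 h.
Proof.
move=> fM hM ex ey q; have : q \in <<[set gx G; gy G]>> by rewrite gen_gxy inE.
have gS : group_set [set q | f q == h q].
  apply/group_setP; split=> [|u v]; last first.
    by rewrite !inE fM hM => /eqP-> /eqP->.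
  rewrite inE; apply/eqP.
  have [f1 h1] := (fM 1 1, hM 1 1).
  by apply: (mulgI (f 1)); rewrite -fM; apply: (mulIg (h 1));
    rewrite -mulgA -hM !mulg1.
have /subsetP sS : <<[set gx G; gy G]>> \subset Group gS.
  by rewrite gen_subG; apply/subsetP=> u /set2P[] ->; rewrite inE ?ex ?ey.
by move/sS; rewrite inE => /eqP.
Qed.

Lemma eq_ev p p' : (forall q, ev p q = ev p' q) -> p = p'.
Proof.
move=> e; apply: val_inj.
by rewrite [LHS]surjective_pairing [RHS]surjective_pairing -!ev_x -!ev_y !e.
Qed.

(** The images of the two generators generate [G], so the default [p] of [insubd] is never
    returned. *)
Lemma ev_insubd p (f : Gbar G -> gT) : {morph f : q q' / q * q'} ->
    f @: [set: Gbar G] = G ->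
  forall q, ev (insubd p (f (gx G), f (gy G))) q = f q.
Proof.
move=> fM imf; pose mf := @Morphism _ _ [set: Gbar G] _ (in2W fM).
have mfE : f @: [set: Gbar G] = mf @* [set: Gbar G] by rewrite morphimEdom.
have onto : F2_onto G (f (gx G)) (f (gy G)).
  have := morphim_gen mf (subsetT [set gx G; gy G]).
  rewrite gen_gxy /F2_onto -[X in X == _]imf mfE => ->.
  by rewrite morphimU !morphim_set1 ?inE.
by apply: eq_morph_gxy; rewrite ?ev_x ?ev_y ?val_insubd ?onto //; apply: evM.
Qed.

(** Precomposition of [ev p] with [phi]; [aact] is postcomposition with an automorphism of [G], so
    the two actions commute. *)
Definition pact p (phi : {perm Gbar G}) : gpair :=
  insubd p (ev p (phi (gx G)), ev p (phi (gy G))).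

Lemma AutTM phi : phi \in Aut [set: Gbar G] -> {morph phi : q q' / q * q'}.
Proof. by move=> Aphi q q'; rewrite -(autmE Aphi) morphM ?inE. Qed.

Lemma ev_pact p phi : phi \in Aut [set: Gbar G] ->
  forall q, ev (pact p phi) q = ev p (phi q).
Proof.
move=> Aphi; apply: (ev_insubd p (f := fun q => ev p (phi q))).
  by move=> q q'; rewrite AutTM // evM.
rewrite -[RHS](im_ev p) morphimEdom; apply/setP=> g.
apply/imsetP/imsetP=> -[q _ ->]; first by exists (phi q).
by exists (phi^-1 q); rewrite ?inE ?permKV.
Qed.

Definition aact (a : {perm gT}) p : gpair :=
  insubd p (a (val p).1, a (val p).2).

Lemma AutGM a : a \in Aut G -> {in G &, {morph a : g h / g * h}}.
Proof. by move=> Aa g h Gg Gh; rewrite -(autmE Aa) morphM. Qed.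

Lemma ev_aact a p : a \in Aut G -> forall q, ev (aact a p) q = a (ev p q).
Proof.
move=> Aa; rewrite /aact -ev_x -ev_y.
apply: (ev_insubd p (f := fun q => a (ev p q))).
  by move=> q q'; rewrite evM AutGM ?mem_ev.
rewrite -[RHS](im_autm Aa) morphimEdom; apply/setP=> g.
apply/imsetP/imsetP=> -[q Gq ->]; first by exists (ev p q); rewrite ?mem_ev.
by have [u <-] := ev_surj p Gq; exists u.
Qed.

Hypotheses (simG : simple G) (nabG : ~~ abelian G).

Lemma normal_im_ev p (K : {group Gbar G}) : K <| [set: Gbar G] ->
  ev p @* K = 1 \/ ev p @* K = G.
Proof.
move=> nK; have [_ normG] := simpleP _ simG.
by apply: normG; rewrite /= -[X in _ <| X](im_ev p) morphim_normal.
Qed.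

(** [ev p'] factors through [ev p]; the resulting endomorphism of [G] is onto, hence bijective by
    finiteness. *)
Lemma ker_ev_aact p p' : 'ker (ev p) \subset 'ker (ev p') ->
  exists2 a, a \in Aut G & p' = aact a p.
Proof.
move=> sK.
have sG : G \subset ev p @* [set: Gbar G] by rewrite im_ev.
pose h := factm sK (subxx _).
pose f := [morphism of restrm sG h].
have fE q : f (ev p q) = ev p' q by apply: factmE; rewrite inE.
have imf : f @* G = G.
  apply/setP=> g; apply/morphimP/idP => [[u _ Gu ->]|Gg].
    by have [q <-] := ev_surj p Gu; rewrite fE mem_ev.
  have [q <-] := ev_surj p' Gg.
  by exists (ev p q); rewrite ?mem_ev // fE.
have injf : 'injm f by rewrite -card_im_injm imf.
exists (aut injf imf); first exact: Aut_aut.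
by apply: eq_ev => q; rewrite ev_aact ?Aut_aut // autE ?mem_ev // fE.
Qed.

(* Goursat: a subdirect product of simple non-abelian groups, no two of whose
   projections are linked by an isomorphism, is the full product. *)
Lemma ev_free (J : seq gpair) p :
    (forall j, j \in J -> forall a, a \in Aut G -> p <> aact a j) ->
  forall g, g \in G -> exists2 q, ev p q = g & forall j, j \in J -> ev j q = 1.
Proof.
move=> pJ; suff [K nK [imK K1]] : exists2 K : {group Gbar G},
    K <| [set: Gbar G] &
    ev p @* K = G /\ forall j q, j \in J -> q \in K -> ev j q = 1.
  move=> g; rewrite -imK => /morphimP[q _ Kq ->]; exists q => // j Jj.
  exact: K1.
elim: J pJ => [|j J IHJ] pJ.
  by exists [set: Gbar G]%G; rewrite ?normal_refl ?im_ev.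
have [i Ji|K nK [imK K1]] := IHJ; first by apply: pJ; rewrite inE Ji orbT.
have nker : 'ker (ev j) <| [set: Gbar G] by apply: ker_normal.
exists (K :&: 'ker (ev j))%G; first exact: normalI.
split=> [|i q]; last first.
  by rewrite inE => /predU1P[->|Ji] /setIP[Kq /mker //]; rewrite (K1 i).
have [im1|//] := normal_im_ev p (normalI nK nker).
(* Otherwise the kernel of [ev j] lies in that of [ev p], which makes [p] an automorphic image of
   [j]. *)
have imj : ev p @* 'ker (ev j) = G.
  have [im1'|//] := normal_im_ev p nker.
  have [a Aa pa] : exists2 a, a \in Aut G & p = aact a j.
    apply: ker_ev_aact; apply/subsetP=> q kq; apply/kerP; rewrite ?inE //.
    have := mem_morphim (ev_morphism p) (in_setT q) kq.
    by rewrite im1' => /set1P.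
  by case: (pJ j (mem_head j J) a Aa pa).
(* Both groups have image [G], while their commutator lies in the intersection, whose image is
   trivial: [G] would be abelian. *)
have sR : [~: K, 'ker (ev j)] \subset K :&: 'ker (ev j).
  have [[_ nK'] [_ nker']] := (andP nK, andP nker).
  rewrite subsetI commg_subl commg_subr; apply/andP.
  by split; apply: subset_trans (subsetT _) _.
case/negP: nabG; apply/commG1P.
have imR := morphimR (ev_morphism p) (subsetT K) (subsetT ('ker (ev j))).
by have := morphimS (ev_morphism p) sR; rewrite imR imK imj im1 => /trivgP.
Qed.

(** Generating pairs are treated one at a time. A pair in the [Aut G]-orbit of an earlier one is
    settled by equivariance; otherwise [ev_free] corrects the values at it without changing the
    earlier ones. *)
Lemma equivariant_choice (R : gpair -> gT -> gT -> Prop) :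
    (forall p, exists g h, [/\ g \in G, h \in G & R p g h]) ->
    (forall a p g h, a \in Aut G -> R p g h -> R (aact a p) (a g) (a h)) ->
  exists q q', forall p, R p (ev p q) (ev p q').
Proof.
move=> Rex Ract.
suff [q [q' Rq]] : exists q q', forall p, p \in enum {: gpair} ->
    R p (ev p q) (ev p q').
  by exists q, q' => p; apply: Rq; rewrite mem_enum.
elim: (enum {: gpair}) => [|p J [q [q' Rq]]]; first by exists 1, 1.
have [[j Jj [a Aa pa]]|pJ] :=
    pselect (exists2 j, j \in J & exists2 a, a \in Aut G & p = aact a j).
  exists q, q' => i /predU1P[->|/Rq //].
  by rewrite pa !ev_aact //; apply/Ract/Rq.
have {}pJ j : j \in J -> forall a, a \in Aut G -> p <> aact a j.
  by move=> Jj a Aa pa; apply: pJ; exists j => //; exists a.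
have [g [h [Gg Gh Rgh]]] := Rex p.
have GV u v : v \in G -> (ev p u)^-1 * v \in G.
  by move=> Gv; rewrite groupM // groupV mem_ev.
have [u pu Ju] := ev_free pJ (GV q g Gg).
have [v pv Jv] := ev_free pJ (GV q' h Gh).
exists (q * u), (q' * v) => i /predU1P[->|Ji].
  by rewrite !evM pu pv !mulKVg.
by rewrite !evM Ju // Jv // !mulg1; apply: Rq.
Qed.

End GeneratingPairs.

Section PermOfFun.

Variable T : finType.

(* 1 when f is not injective. *)
Definition perm_fun (f : T -> T) : {perm T} :=
  odflt 1 [pick s : {perm T} | [forall x, s x == f x]].

Lemma perm_funE f : injective f -> perm_fun f =1 f.
Proof.
move=> f_inj x; rewrite /perm_fun; case: pickP => [s /forallP sf | nof] /=.
  exact/eqP.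
by have /negP[] := nof (perm f_inj); apply/forallP=> y; rewrite permE.
Qed.

End PermOfFun.

(** * Generating pairs up to conjugation, and the outer automorphisms of Gbar *)

Section ConjugacyClasses.

Variables (gT : finGroupType) (G : {group gT}).
Local Notation gpair := (gpair G).
Local Notation Gb := [set: Gbar G]%G.
Implicit Types (p : gpair) (q : Gbar G).

Lemma aactM a b p : a \in Aut G -> b \in Aut G ->
  aact b (aact a p) = aact (a * b) p.
Proof.
by move=> Aa Ab; apply: eq_ev => q; rewrite !ev_aact ?groupM // permM.
Qed.

Lemma pactM s t p : s \in Aut Gb -> t \in Aut Gb ->
  pact (pact p s) t = pact p (t * s).
Proof.
by move=> As At; apply: eq_ev => q; rewrite !ev_pact ?groupM // permM.
Qed.

Lemma aact1 p : aact 1 p = p.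
Proof. by apply: eq_ev => q; rewrite ev_aact ?group1 // perm1. Qed.

Lemma pact1 p : pact p 1 = p.
Proof. by apply: eq_ev => q; rewrite ev_pact ?group1 // perm1. Qed.

Lemma pact_aact a s p : a \in Aut G -> s \in Aut Gb ->
  pact (aact a p) s = aact a (pact p s).
Proof.
by move=> Aa As; apply: eq_ev => q; rewrite !(ev_pact, ev_aact).
Qed.

Lemma mem_conj_aut (rT : finGroupType) (K : {group rT}) g :
  g \in K -> conj_aut K g \in Aut K.
Proof.
move=> Kg; apply: (subsetP (Aut_conj_aut K K)).
by apply: mem_morphim; rewrite ?(subsetP (normG K)).
Qed.

Definition gconj p p' := [exists g in G, p' == aact (conj_aut G g) p].

Lemma gconjP p p' :
  reflect (exists2 g, g \in G & forall q, ev p' q = ev p q ^ g) (gconj p p').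
Proof.
apply: (iffP exists_inP) => -[g Gg].
  move/eqP->; exists g => // q.
  by rewrite ev_aact ?mem_conj_aut ?conj_autE ?mem_ev.
move=> pp'; exists g => //; apply/eqP/eq_ev => q.
by rewrite ev_aact ?mem_conj_aut ?conj_autE ?mem_ev.
Qed.

Lemma gconj_refl p : gconj p p.
Proof. by apply/gconjP; exists 1 => // q; rewrite conjg1. Qed.

Lemma gconj_sym p p' : gconj p p' = gconj p' p.
Proof.
by apply/gconjP/gconjP => -[g Gg pp']; exists g^-1; rewrite ?groupV // => q;
  rewrite pp' conjgK.
Qed.

Lemma gconj_trans p p' p'' : gconj p p' -> gconj p' p'' -> gconj p p''.
Proof.
move=> /gconjP[g Gg pp'] /gconjP[h Gh p'p'']; apply/gconjP.
by exists (g * h) => [|q]; rewrite ?groupM // p'p'' pp' conjgM.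
Qed.

Definition canon p := odflt p [pick p' | gconj p p'].

Lemma gconj_canon p : gconj p (canon p).
Proof. by rewrite /canon; case: pickP => //= _; apply: gconj_refl. Qed.

Lemma gconj_canonE p p' : gconj p p' -> canon p = canon p'.
Proof.
move=> pp'; rewrite /canon (@eq_pick _ _ (gconj p')) => [|i].
  by case: pickP => // /(_ p'); rewrite gconj_refl.
apply/idP/idP => [pi|]; last exact: gconj_trans pp'.
by apply: gconj_trans pi; rewrite gconj_sym.
Qed.

(* Generating pairs up to conjugation by G, as canonical representatives. *)
Record gclass :=
  GClass { gpair_of_class : gpair;
           _ : canon gpair_of_class == gpair_of_class }.

HB.instance Definition _ := [isSub for gpair_of_class].
HB.instance Definition _ := [Finite of gclass by <:].

Lemma canon_id p : canon (canon p) == canon p.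
Proof. by rewrite -(gconj_canonE (gconj_canon p)). Qed.

Definition cls p : gclass := GClass (canon_id p).

Lemma clsP p p' : reflect (cls p = cls p') (gconj p p').
Proof.
apply: (iffP idP) => [/gconj_canonE pp'|/(congr1 val)/= pp'].
  exact: val_inj.
apply: gconj_trans (gconj_canon p) _.
by rewrite pp' gconj_sym gconj_canon.
Qed.

Lemma cls_val (x : gclass) : cls (val x) = x.
Proof. by apply: val_inj; apply/eqP; apply: (valP x). Qed.

Lemma gconj_aact a p p' : a \in Aut G -> gconj p p' ->
  gconj (aact a p) (aact a p').
Proof.
move=> Aa /gconjP[g Gg pp']; apply/gconjP; exists (a g) => [|q].
  by rewrite Aut_closed.
by rewrite !ev_aact // pp' -!(autmE Aa) morphJ ?mem_ev.
Qed.

Lemma gconj_pact s p p' : s \in Aut Gb -> gconj p p' ->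
  gconj (pact p s) (pact p' s).
Proof.
move=> As /gconjP[g Gg pp']; apply/gconjP; exists g => // q.
by rewrite !ev_pact.
Qed.

Definition cls_perm (F : gpair -> gpair) : {perm gclass} :=
  perm_fun (fun x => cls (F (val x))).

(** The left inverse [F'] makes the induced map on classes injective, so [perm_fun] does not fall
    back on 1. *)
Lemma cls_permE F F' p :
    (forall i j, gconj i j -> gconj (F i) (F j)) ->
    (forall i j, gconj i j -> gconj (F' i) (F' j)) ->
  cancel F F' -> cls_perm F (cls p) = cls (F p).
Proof.
move=> cF cF' FK.
have clsF i : cls (F (val (cls i))) = cls (F i).
  by apply/esym/clsP/cF/clsP; rewrite cls_val.
rewrite /cls_perm perm_funE ?clsF //.
apply: (can_inj (g := fun x => cls (F' (val x)))) => x.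
have clsF' i : cls (F' (val (cls i))) = cls (F' i).
  by apply/esym/clsP/cF'/clsP; rewrite cls_val.
by rewrite clsF' FK cls_val.
Qed.

(* The inverse makes rho a morphism, since precomposition reverses products.
   Hiding the bodies of rho and sigma behind an opaque proof keeps unification
   from unfolding them. *)
Fact rho_subproof : {f : {perm Gbar G} -> {perm gclass} |
  forall s p, s \in Aut Gb -> f s (cls p) = cls (pact p s^-1)}.
Proof.
exists (fun s => cls_perm (fun p => pact p s^-1)) => s p As.
have AVs := groupVr As.
apply: (cls_permE (F' := fun p => pact p s)) => [i j|i j|i];
  rewrite ?pactM ?mulgV ?pact1 //; exact: gconj_pact.
Qed.

Fact sigma_subproof : {f : {perm gT} -> {perm gclass} |
  forall a p, a \in Aut G -> f a (cls p) = cls (aact a p)}.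
Proof.
exists (fun a => cls_perm (aact a)) => a p Aa; have AVa := groupVr Aa.
apply: (cls_permE (F' := aact a^-1)) => [i j|i j|i];
  rewrite ?aactM ?mulgV ?aact1 //; exact: gconj_aact.
Qed.

Definition rho := sval rho_subproof.
Definition sigma := sval sigma_subproof.

Lemma rhoE s p : s \in Aut Gb -> rho s (cls p) = cls (pact p s^-1).
Proof. exact: (svalP rho_subproof). Qed.

Lemma sigmaE a p : a \in Aut G -> sigma a (cls p) = cls (aact a p).
Proof. exact: (svalP sigma_subproof). Qed.

Lemma rhoM : {in Aut Gb &, {morph rho : s t / s * t}}.
Proof.
move=> s t As At; apply/permP=> x; rewrite -[x]cls_val [RHS]permM.
by rewrite !rhoE ?groupM // pactM ?groupV // invMg.
Qed.

Lemma sigmaM : {in Aut G &, {morph sigma : a b / a * b}}.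
Proof.
move=> a b Aa Ab; apply/permP=> x; rewrite -[x]cls_val [RHS]permM.
by rewrite !sigmaE ?groupM // aactM.
Qed.

Canonical rho_morphism := Morphism rhoM.
Canonical sigma_morphism := Morphism sigmaM.

Lemma rho1 : rho 1 = 1.
Proof. exact: (morph1 rho_morphism). Qed.

Lemma rhoX n s : s \in Aut Gb -> rho (s ^+ n) = rho s ^+ n.
Proof. exact: (morphX rho_morphism n). Qed.

Lemma rhoV s : s \in Aut Gb -> rho s^-1 = (rho s)^-1.
Proof. exact: (morphV rho_morphism). Qed.

Lemma rho_sigma s a x : s \in Aut Gb -> a \in Aut G ->
  rho s (sigma a x) = sigma a (rho s x).
Proof.
move=> As Aa; have AVs := groupVr As.
by rewrite -[x]cls_val sigmaE // !rhoE // sigmaE // pact_aact.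
Qed.

Lemma sigma_Inn : Inn G \subset 'ker sigma.
Proof.
apply/subsetP=> _ /morphimP[g _ Gg ->].
have Ag := mem_conj_aut Gg; apply/kerP=> //.
apply/permP=> x; rewrite perm1 -[x]cls_val sigmaE //.
apply/esym/clsP/gconjP; exists g => // q.
by rewrite ev_aact // conj_autE ?mem_ev.
Qed.

Hypotheses (simG : simple G) (nabG : ~~ abelian G).

(** If [rho s] is trivial, then at each pair [s] acts as conjugation by an element of [G], and
    [equivariant_choice] glues these into one element of [Gbar G]. Conversely, conjugation by [q]
    acts on [p] as conjugation by [ev p q]. *)
Lemma rho_eq1 s : s \in Aut Gb -> (rho s == 1) = (s \in Inn Gb).
Proof.
move=> As; have AVs := groupVr As; apply/eqP/idP => [rs1|].
  have [|a p g _ Aa [Gg Rg]|q [_ sq]] := equivariant_choice simG nabG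
      (R := fun p g _ => g \in G /\ forall q, ev p (s q) = ev p q ^ g).
  - move=> p; have /clsP/gconjP[g Gg pg] : cls p = cls (pact p s).
      have := rhoE p AVs; rewrite invgK => <-.
      by rewrite rhoV // rs1 invg1 perm1.
    by exists g, 1; split=> //; split=> // q; rewrite -pg ev_pact.
  - split=> [|q]; first by rewrite Aut_closed.
    by rewrite !ev_aact // Rg -!(autmE Aa) morphJ ?mem_ev.
  have Gq := in_setT q; have Nq := subsetP (normG Gb) q Gq.
  suff -> : s = conj_aut Gb q by apply: mem_morphim.
  apply: (eq_Aut As); first by rewrite mem_conj_aut ?inE.
  move=> u _; apply: ev_inj => p; rewrite conj_autE ?inE // (sq p).2.
  by rewrite (morphJ (ev_morphism p)) ?inE.
case/morphimP=> q _ _ ->; have Aq := mem_conj_aut (in_setT q : q \in Gb).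
have AVq := groupVr Aq.
suff r1 : rho (conj_aut Gb q)^-1 = 1.
  by apply: invg_inj; rewrite -rhoV // r1 invg1.
apply/permP=> x; rewrite perm1 -[x]cls_val rhoE // invgK.
apply/esym/clsP/gconjP; exists (ev (val x) q); rewrite ?mem_ev // => u.
by rewrite ev_pact // conj_autE ?inE // (morphJ (ev_morphism _)) ?inE.
Qed.

(** The centre is trivial, which is why conjugation by [G] acts freely on generating pairs. *)
Lemma cent_trivG g : g \in G -> (forall h, h \in G -> h ^ g = h) -> g = 1.
Proof.
move=> Gg cg; have [_ normG] := simpleP _ simG.
have Zg : g \in 'Z(G).
  by apply/centerP; split=> // h Gh; rewrite /commute [RHS]conjgC cg.
have [Z1|ZG] := normG _ (center_normal G).
  by move: Zg; rewrite Z1 => /set1P.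
by case/negP: nabG; rewrite -ZG center_abelian.
Qed.

(** [equivariant_choice] lifts [c] to a bijection [F] of generating pairs that commutes with
    [Aut G]; the automorphism [phi] is then determined by [ev p (phi u) = ev (F p) u]. *)
Lemma rho_surj (c : {perm gclass}) :
    (forall a x, a \in Aut G -> c (sigma a x) = sigma a (c x)) ->
  exists2 s, s \in Aut Gb & rho s = c.
Proof.
move=> c_sigma.
have [p|a p g h Aa [p' [vp' cp']]|q [q' Rq]] := equivariant_choice simG nabG
    (R := fun p g h => exists p', [/\ val p' = (g, h) & cls p' = c (cls p)]).
- pose p' := val (c (cls p)); exists (val p').1, (val p').2.
  rewrite -ev_x -ev_y !mem_ev; split=> //; exists p'.
  by rewrite ev_x ev_y -surjective_pairing cls_val.
- exists (aact a p'); split; last by rewrite -!sigmaE // cp' c_sigma.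
  by rewrite [LHS]surjective_pairing -ev_x -ev_y !ev_aact // ev_x ev_y vp'.
pose F p : gpair := insubd p (ev p q, ev p q').
have valF p : val (F p) = (ev p q, ev p q').
  by have [p' [vp' _]] := Rq p; rewrite /F -vp' valKd.
have clsF p : cls (F p) = c (cls p).
  by have [p' [vp' <-]] := Rq p; rewrite /F -vp' valKd.
have Fx p : ev (F p) (gx G) = ev p q by rewrite ev_x valF.
have Fy p : ev (F p) (gy G) = ev p q' by rewrite ev_y valF.
have F_aact a p : a \in Aut G -> F (aact a p) = aact a (F p).
  move=> Aa; apply: val_inj; rewrite [RHS]surjective_pairing valF.
  by rewrite -ev_x -ev_y !ev_aact // Fx Fy.
(* If [F p = F p'], then [p'] is the conjugate of [p] by some [g], and equivariance makes [g]
   centralize the generating pair [F p]. *)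
have F_inj : injective F.
  move=> p p' Fpp'.
  have [g Gg defp'] : exists2 g, g \in G & p' = aact (conj_aut G g) p.
    have /clsP/exists_inP[g Gg /eqP->] : cls p = cls p'.
      by apply: (@perm_inj _ c); rewrite -!clsF Fpp'.
    by exists g.
  suff g1 : g = 1 by rewrite defp' g1 morph1 aact1.
  apply: cent_trivG => // h Gh; have [u <-] := ev_surj (F p) Gh.
  rewrite {2}Fpp' defp' F_aact ?mem_conj_aut // ev_aact ?mem_conj_aut //.
  by rewrite conj_autE ?mem_ev.
have /choice[phi phiE] u : exists v, forall p, ev p v = ev (F p) u.
  have [p|a p g _ Aa ->|v [_ uv]] := equivariant_choice simG nabG
      (R := fun p g _ => g = ev (F p) u).
  - by exists (ev (F p) u), 1; rewrite mem_ev group1.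
  - by rewrite F_aact // ev_aact.
  - by exists v.
have phi_inj : injective phi.
  move=> u v uv; apply: ev_inj => p.
  have /codomP[i ->] := injF_onto F_inj p.
  by rewrite -!phiE uv.
have phiM : {morph phi : u v / u * v}.
  by move=> u v; apply: ev_inj => p; rewrite evM !phiE evM.
have Aphi : perm phi_inj \in Aut Gb.
  rewrite inE; apply/andP; split; first by apply/subsetP=> u; rewrite inE.
  by apply/morphicP=> u v _ _; rewrite !permE phiM.
(* The inverse matches the one in the definition of [rho]. *)
exists (perm phi_inj)^-1; first by rewrite groupV.
apply/permP=> x; rewrite -[x]cls_val rhoE ?groupV // invgK.
rewrite -clsF; congr cls; apply: eq_ev => u.
by rewrite ev_pact // permE phiE.
Qed.

End ConjugacyClasses.

Arguments rho {gT G} s.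

(** * The group GT_1 *)

(** The terms of a composition series are subnormal, so its factors are among those that
    [simple_factors_in] controls. *)
Lemma comps_factor (gT : finGroupType) (G : {group gT}) s (K : section gT) :
    comps G s -> K \in mkfactors G s ->
  exists A L : {group gT},
    [/\ A <|<| G, L <| A, simple (A / L) & K \isog A / L].
Proof.
elim: s G => [|A s IHs] G //= compGs.
have /compsP[_ /= /andP[maxA _]] := compGs.
have nsAG := maxnormal_normal maxA.
rewrite /mkfactors /= inE => /predU1P[->|Ks].
  exists G, A; split=> //; first exact: subnormal_refl.
    by rewrite quotient_simple.
  exact: (section_reprP (mkSec G A)).
have [B [L [snB nsL simBL isoK]]] := IHs _ (comps_cons compGs) Ks.
exists B, L; split=> //; apply: subnormal_trans snB _.
exact: normal_subnormal.
Qed.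

(** [s] inverts [s * t], so the group is the product of [<[s * t]>] and [<[s]>]. *)
Lemma card_gen_invol_dvd6 (gT : finGroupType) (s t : gT) :
  s * s = 1 -> t * t = 1 -> (s * t) ^+ 3 = 1 -> #|<<[set s; t]>>| %| 6.
Proof.
move=> s2 t2 st3.
have sV : s^-1 = s by apply/eqP; rewrite eq_invg_mul s2.
have tV : t^-1 = t by apply/eqP; rewrite eq_invg_mul t2.
have nst : <[s]> \subset 'N(<[s * t]>).
  rewrite cycle_subG; apply/normP; rewrite -cycleJ -[RHS]cycleV; congr <[_]>.
  by rewrite conjgE invMg sV tV !mulgA s2 mul1g.
have sub : <<[set s; t]>> \subset <[s * t]> <*> <[s]>.
  have Js : s \in <[s * t]> <*> <[s]> by rewrite mem_gen // inE cycle_id orbT.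
  have Jst : s * t \in <[s * t]> <*> <[s]> by rewrite mem_gen // inE cycle_id.
  rewrite gen_subG; apply/subsetP=> u /set2P[] -> //.
  by rewrite -[X in X \in _](mulKg s t) groupM ?groupV.
apply: dvdn_trans (cardSg sub) _; rewrite /= norm_joinEr //.
have dv : #|<[s * t]>| * #|<[s]>| %| 3 * 2.
  by apply: dvdn_mul; rewrite -orderE order_dvdn ?st3 ?expgS ?expg0 ?mulg1 ?s2.
by apply: dvdn_trans dv; rewrite mul_cardG dvdn_mulr.
Qed.

Lemma cent_morphim_genP (aT : finGroupType) (X : finType) (A : {group aT})
    (f : {morphism A >-> {perm X}}) (s t c : {perm X}) :
  reflect [/\ forall a x, a \in A -> c (f a x) = f a (c x),
              c \in 'C[s] & c \in 'C[t]]
          (c \in 'C(f @* A <*> <<[set s; t]>>)).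
Proof.
rewrite centY cent_gen centU !cent_set1 !in_setI.
apply: (iffP and3P) => -[cs ct cd]; split=> //.
  by move=> a x Aa; have /cent_permE := cs; apply; apply: mem_morphim.
by apply/cent_permE => _ x /morphimP[a Aa _ ->]; apply: cs.
Qed.

Section GT1.

Variables (gT : finGroupType) (G : {group gT}).
Local Notation Gb := [set: Gbar G]%G.
Implicit Types (p : gpair G) (q : Gbar G).

(* Abstract versions of theta, delta and GT1_aut, which unification would
   otherwise unfold. *)
Variables (t d : {perm Gbar G}) (A : {group {perm Gbar G}}).
Hypotheses (At : t \in Aut Gb) (tx : t (gx G) = gy G) (ty : t (gy G) = gx G).
Hypotheses (Ad : d \in Aut Gb) (dx : d (gx G) = (gy G)^-1 * (gx G)^-1)
  (dy : d (gy G) = gy G).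
Hypothesis AP : forall s, s \in A =
  (s \in Aut Gb) && [&& s (gx G) \in gx G ^: Gb,
     coset (Inn Gb) s \in 'C[coset (Inn Gb) t] &
     coset (Inn Gb) s \in 'C[coset (Inn Gb) d]].

Lemma theta_sq : t * t = 1.
Proof.
apply/permP=> q; rewrite perm1; apply: eq_morph_gxy q => //.
- by apply: AutTM; rewrite groupM.
- by rewrite permM tx ty.
- by rewrite permM ty tx.
Qed.

Lemma AutTV s q : s \in Aut Gb -> s q^-1 = (s q)^-1.
Proof. by move=> As; rewrite -!(autmE As) morphV ?inE. Qed.

(** An involution modulo inner automorphisms, which [rho] kills: [rho t] and [rho d] satisfy the
    relations of the symmetric group of degree 3. *)
Lemma delta_sq : d * d = conj_aut Gb (gy G).
Proof.
apply/permP=> q; apply: eq_morph_gxy q.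
- by apply: AutTM; rewrite groupM.
- by apply: AutTM; rewrite mem_conj_aut ?inE.
- rewrite permM conj_autE ?inE // dx (AutTM Ad) !AutTV // dx dy conjgE.
  by rewrite invMg !invgK !mulgA.
- by rewrite permM conj_autE ?inE // !dy conjgE mulKg.
Qed.

Lemma theta_delta_cube : (t * d) ^+ 3 = 1.
Proof.
have Atd : t * d \in Aut Gb by rewrite groupM.
have tdx : (t * d) (gx G) = gy G by rewrite permM tx.
have tdy : (t * d) (gy G) = (gy G)^-1 * (gx G)^-1 by rewrite permM ty.
apply/permP=> q; rewrite perm1; apply: eq_morph_gxy q => //.
- by apply: AutTM; rewrite groupX.
- rewrite permX /=.
  by rewrite tdx tdy (AutTM Atd) !AutTV // tdx tdy invMg !invgK mulgK.
- rewrite permX /=.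
  by rewrite tdy (AutTM Atd) !AutTV // tdx tdy invMg !invgK mulgK.
Qed.

Hypotheses (simG : simple G) (nabG : ~~ abelian G).

(** Commuting with the image of [Aut G] characterises the image of [rho]; commuting with the other
    two generators expresses the condition on the classes of [theta] and [delta]. *)
Definition sym_group := (sigma G @* Aut G <*> <<[set rho t; rho d]>>)%G.

Lemma class_commute s u : s \in Aut Gb -> u \in Aut Gb ->
  (coset (Inn Gb) s \in 'C[coset (Inn Gb) u]) = (rho s \in 'C[rho u]).
Proof.
move=> As Au; have nA := subsetP (normal_norm (Inn_normal Gb)).
have [ns nu] := (nA s As, nA u Au).
have Ac : [~ s, u] \in Aut Gb by rewrite groupR.
have -> : (coset (Inn Gb) s \in 'C[coset (Inn Gb) u]) =
          (coset (Inn Gb) [~ s, u] == 1).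
  by rewrite morphR //; apply/cent1P/commgP.
have -> : (rho s \in 'C[rho u]) = (rho [~ s, u] == 1).
  by rewrite (morphR (rho_morphism G)) //; apply/cent1P/commgP.
rewrite rho_eq1 //; apply/eqP/idP => [|Is]; last exact: coset_id.
exact: (coset_idr (nA _ Ac)).
Qed.

Definition class_type (x : gclass G) : {set gT} * {set gT} :=
  (ev (val x) (gx G) ^: G, ev (val x) (gy G) ^: G).

Lemma class_type_cls p :
  class_type (cls p) = (ev p (gx G) ^: G, ev p (gy G) ^: G).
Proof.
have /clsP/gconjP[g Gg e] : cls p = cls (val (cls p)) by rewrite cls_val.
by rewrite /class_type !e !classGidl.
Qed.

(* This is where commuting with theta is used: it makes the class of the second
   generator an invariant too. *)
Lemma class_type_theta x : (class_type x).2 = (class_type (rho t x)).1.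
Proof.
have tV : t^-1 = t by apply/eqP; rewrite eq_invg_mul theta_sq.
by rewrite -[x]cls_val rhoE // !class_type_cls /= tV ev_pact // tx.
Qed.

Lemma class_type1_rho s x : s \in Aut Gb -> s (gx G) \in gx G ^: Gb ->
  (class_type (rho s x)).1 = (class_type x).1.
Proof.
move=> As /imsetP[q _ sx].
rewrite -[x]cls_val rhoE // !class_type_cls /= ev_pact ?groupV //.
have defx : gx G = (s^-1 (gx G)) ^ (s^-1 q).
  apply: (@perm_inj _ s); rewrite -[in RHS](autmE As) morphJ ?inE //=.
  by rewrite !autmE !permKV.
by rewrite [in RHS]defx (morphJ (ev_morphism _)) ?inE //= classGidl ?mem_ev.
Qed.

Lemma rho_GT1P (c : {perm gclass G}) :
  reflect (c \in 'C(sym_group) /\ forall x, class_type (c x) = class_type x)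
          (c \in rho @* A).
Proof.
apply: (iffP idP) => [|[/cent_morphim_genP[c_sigma ct cd] Tc]].
  case/morphimP=> s As; rewrite AP => /andP[_ /and3P[sx st sd]] ->.
  rewrite (class_commute As At) in st; rewrite (class_commute As Ad) in sd.
  split=> [|x].
    by apply/cent_morphim_genP; split=> // a x Aa; apply: rho_sigma.
  rewrite [LHS]surjective_pairing [RHS]surjective_pairing class_type1_rho //.
  congr (_, _); rewrite !class_type_theta.
  have /cent1P/permP/(_ x) := st; rewrite ![in X in X -> _]permM => ->.
  by rewrite class_type1_rho.
have [s As defc] := rho_surj simG nabG c_sigma.
rewrite -defc; apply: mem_morphim => //; rewrite AP As.
rewrite (class_commute As At) (class_commute As Ad) defc ct cd /= andbT.
(* At each pair the values of [s (gx G)] and [gx G] are conjugate in [G]; gluing the conjugating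
   elements gives conjugacy in [Gbar G]. *)
have [|a p g _ Aa [Gg Rg]|q [_ sq]] := equivariant_choice simG nabG
    (R := fun p g _ => g \in G /\ ev p (s (gx G)) = ev p (gx G) ^ g).
- move=> p; have := Tc (c^-1 (cls p)); rewrite permKV -defc -rhoV //.
  rewrite rhoE ?groupV // invgK !class_type_cls => -[e _].
  have : ev (pact p s) (gx G) \in ev p (gx G) ^: G by rewrite e class_refl.
  by rewrite ev_pact // => /imsetP[g Gg eg]; exists g, 1.
- split; first by rewrite Aut_closed.
  by rewrite !ev_aact // Rg -!(autmE Aa) morphJ ?mem_ev.
apply/imsetP; exists q; rewrite ?inE //; apply: ev_inj => p.
by rewrite (sq p).2 (morphJ (ev_morphism p)) ?inE.
Qed.

(** Conjugation is free, so the points of the fiber yield [#|G|] pairs each, all distinct, in a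
    product of two conjugacy classes of size at most [m]. *)
Lemma class_type_fiber (m : nat) x : m = (\max_(C in classes G) #|C|)%N ->
  #|[set x' | class_type x' == class_type x]| <= m ^ 2 %/ #|G|.
Proof.
move=> defm; rewrite leq_divRL ?cardG_gt0 // -cardsX.
have le_m C : C \in classes G -> #|C| <= m.
  rewrite defm.
  exact: (@leq_bigmax_cond _ (mem (classes G)) (fun C => #|C|)).
set C1 := (class_type x).1; set C2 := (class_type x).2.
have leC : #|setX C1 C2| <= m ^ 2.
  by rewrite cardsX expnS expn1 leq_mul // le_m // mem_classes // mem_ev.
apply: leq_trans leC.
pose f (u : gclass G * gT) :=
  (ev (val u.1) (gx G) ^ u.2, ev (val u.1) (gy G) ^ u.2).
rewrite -(card_in_imset (f := f)).
  apply/subset_leq_card/subsetP=> _ /imsetP[[y g] /setXP[Ty Gg] ->].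
  move: Ty; rewrite inE => /eqP Ty.
  by apply/setXP; rewrite /C1 /C2 -Ty /= !memJ_class.
move=> [y g] [z h] /setXP[_ Gg] /setXP[_ Gh] [ex ey].
have eyz q : ev (val y) q ^ g = ev (val z) q ^ h.
  apply: (eq_morph_gxy (f := fun u => ev (val y) u ^ g)
                       (h := fun u => ev (val z) u ^ h)) => // u v;
    by rewrite evM conjMg.
have yz : y = z.
  rewrite -[y]cls_val -[z]cls_val; apply/clsP/gconjP.
  exists (g * h^-1) => [|q]; first by rewrite groupM ?groupV.
  by rewrite conjgM eyz conjgK.
congr (_, _) => //; rewrite -yz in eyz.
apply/eqP; rewrite eq_mulgV1; apply/eqP; apply: (cent_trivG simG nabG).
  by rewrite groupM ?groupV.
move=> k Gk; have [q <-] := ev_surj (val y) Gk.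
by rewrite conjgM eyz conjgK.
Qed.

Variable Pr : forall gT : finGroupType, {group gT} -> Prop.
Hypothesis Pr_isog : forall (aT rT : finGroupType)
  (A : {group aT}) (B : {group rT}), A \isog B -> Pr A -> Pr B.
Hypothesis Pr23 : forall (gT : finGroupType) (G : {group gT}),
  #|G| = 2 \/ #|G| = 3 -> Pr G.
Hypothesis secOut : simple_sections_in Pr (Out_group G).

(** [sigma] kills [Inn G], so its image is a quotient of [Out G]; [rho t] and [rho d] centralize
    this image and generate a group of order dividing 6. *)
Lemma simple_sections_sym_group : simple_sections_in Pr sym_group.
Proof.
have secS : simple_sections_in Pr (sigma G @* Aut G)%G.
  have sK : 'ker (coset (Inn G)) \subset 'ker (sigma G).
    by rewrite ker_coset sigma_Inn.
  have sN := normal_norm (Inn_normal G).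
  have -> : (sigma G @* Aut G)%G = (factm sK sN @* Out_group G)%G.
    by apply/group_inj; rewrite /= -(morphim_factm sK sN).
  exact: (simple_sections_morphim Pr_isog).
have cS : <<[set rho t; rho d]>> \subset 'C(sigma G @* Aut G).
  rewrite gen_subG; apply/subsetP=> u /set2P[] ->;
    by apply/cent_permE=> _ x /morphimP[a Aa _ ->]; rewrite /= rho_sigma.
have nS : sym_group \subset 'N(sigma G @* Aut G).
  by rewrite join_subG normG (subset_trans cS) ?cent_sub.
apply: (simple_sections_ext Pr_isog nS (f := coset _)).
  by apply: simple_sectionsS secS; rewrite /= ker_coset subsetIr.
apply: simple_sections_dvd24 => //=.
rewrite -[coset _ @* _]quotientE quotientYidl ?(subset_trans cS) ?cent_sub //.
apply: dvdn_trans (dvdn_quotient _ _) _.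
apply: (@dvdn_trans 6); last by [].
apply: card_gen_invol_dvd6.
- by rewrite -rhoM // theta_sq rho1.
- rewrite -rhoM // delta_sq; apply/eqP; rewrite rho_eq1 ?mem_conj_aut ?inE //.
  have Gy := in_setT (gy G); have Ny := subsetP (normG Gb) _ Gy.
  exact: mem_morphim.
- by rewrite -rhoM // -rhoX ?groupM // theta_delta_cube rho1.
Qed.

Variable m : nat.
Hypothesis defm : m = (\max_(C in classes G) #|C|)%N.
Hypothesis PrA : forall r, 4 < r -> r <= m ^ 2 %/ #|G| -> Pr 'Alt_('I_r).

(** [rho] has kernel [Inn Gb], so it identifies the quotient with the permutation group described by
    [rho_GT1P]. *)
Lemma simple_factors_GT1 : simple_factors_in Pr (A / Inn Gb)%G.
Proof.
have sA : A \subset Aut Gb by apply/subsetP=> s; rewrite AP => /andP[].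
have facA : simple_factors_in Pr (rho @* A)%G.
  apply: (simple_factors_cent_fibers Pr_isog Pr23 (T := class_type)
    (k := m ^ 2 %/ #|G|) (H := sym_group)) => //.
  - exact: rho_GT1P.
  - by move=> x; apply: class_type_fiber.
  - exact: simple_sections_sym_group.
have kerA : 'ker_A rho = Inn Gb.
  apply/setP=> s; apply/setIP/idP => [[As] | Is].
    by move/mker/eqP; rewrite rho_eq1 // (subsetP sA).
  have AIs := subsetP (normal_sub (Inn_normal Gb)) s Is.
  split; last by apply/kerP=> //; apply/eqP; rewrite rho_eq1.
  have Is1 : coset (Inn Gb) s = 1 by apply: coset_id.
  rewrite AP AIs Is1 !group1 !andbT /=.
  have /morphimP[q _ _ ->] := Is.
  by rewrite conj_autE ?inE // memJ_class ?in_setT.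
have := first_isog_loc (rho_morphism G) sA.
rewrite kerA => /isogP[f /trivgP kf imf].
apply: (simple_factors_ext Pr_isog (subxx _) (f := f)).
  apply: (@simple_sections_factors Pr); apply: simple_sections_dvd24 => //.
  by rewrite /= kf (setIidPr (sub1G _)) cards1.
by have -> : (f @* (A / Inn Gb))%G = (rho @* A)%G by apply: group_inj.
Qed.

End GT1.

Theorem theorem1p2 (gT : finGroupType) (G : {group gT}) (m : nat) :
  simple G -> ~~ abelian G ->
  m = (\max_(C in classes G) #|C|)%N ->
  forall (s : seq {group coset_of (Inn [set: Gbar G])})
         (K : section (coset_of (Inn [set: Gbar G]))),
  comps (GT1_group G) s -> K \in mkfactors (GT1_group G) s ->
  [\/ K \isog Zp 2,
      K \isog Zp 3,
      exists H L : {group coset_of (Inn G)},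
        [/\ H \subset Out G, L <| H & K \isog H / L] |
      exists r : nat,
        (r%:R <= (m ^ 2)%:R / #|G|%:R :> rat)%R /\ K \isog 'Alt_('I_r)].
Proof.
move=> simG nabG defm s K compGT K_s.
pose Pr (hT : finGroupType) (A : {group hT}) :=
  [\/ A \isog Zp 2,
      A \isog Zp 3,
      exists H L : {group coset_of (Inn G)},
        [/\ H \subset Out G, L <| H & A \isog H / L] |
      exists r : nat,
        (r%:R <= (m ^ 2)%:R / #|G|%:R :> rat)%R /\ A \isog 'Alt_('I_r)].
have Pr_isog (aT rT : finGroupType) (A : {group aT}) (B : {group rT}) :
  A \isog B -> Pr aT A -> Pr rT B.
  rewrite isog_sym /Pr => isoBA [iso|iso|[H [L [sH nL iso]]]|[r [le_r iso]]].
  - by apply: Or41; apply: isog_trans isoBA iso.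
  - by apply: Or42; apply: isog_trans isoBA iso.
  - apply: Or43; exists H, L; split=> //; exact: isog_trans isoBA iso.
  - apply: Or44; exists r; split=> //; exact: isog_trans isoBA iso.
have Pr23 (hT : finGroupType) (A : {group hT}) :
  #|A| = 2 \/ #|A| = 3 -> Pr hT A.
  have isoZp p : prime p -> #|A| = p -> A \isog Zp p.
    move=> p_pr oA; have p_gt0 := prime_gt0 p_pr.
    rewrite isog_cyclic_card ?prime_cyclic ?oA ?card_Zp //=.
  by case=> oA; [apply: Or41 | apply: Or42]; apply: isoZp.
have secOut : simple_sections_in Pr (Out_group G).
  move=> A L sA nL _; apply: Or43; exists A, L; split=> //; exact: isog_refl.
have PrA r : 4 < r -> r <= m ^ 2 %/ #|G| -> Pr _ 'Alt_('I_r).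
  (* The bound by the integer quotient says [r * #|G| <= m ^ 2], which is the rational bound of the
     theorem. *)
  move=> _; rewrite leq_divRL ?cardG_gt0 // => le_r.
  apply: Or44; exists r; split; last exact: isog_refl.
  rewrite Num.Theory.ler_pdivlMr ?Num.Theory.ltr0n ?cardG_gt0 //.
  by rewrite -GRing.natrM Num.Theory.ler_nat.
have [[At tx ty] [Ad dx dy]] := (thetaP G, deltaP G).
have facGT : simple_factors_in Pr (GT1_group G).
  apply: (simple_factors_GT1 At tx ty Ad dx dy _ simG nabG Pr_isog Pr23 secOut
    defm PrA (A := GT1_aut_group G)) => u.
  by rewrite inE.
have [A [L [snA nL simAL isoK]]] := comps_factor compGT K_s.
apply: Pr_isog (facGT A L snA nL simAL).
by rewrite isog_sym.
Qed.
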